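(* Let $\varepsilon>0$ be sufficiently small and $\phi$ an even Hecke–Maass cusp form. Let $l$ be an integer with $1\ll l\ll t_\phi^{\frac16-\varepsilon}$ and assume $|\lambda_\phi(l)|\ge\varepsilon$. Put $y_l=\frac{t_\phi}{2\pi l}$ (so $t_\phi^{\frac56+\varepsilon}\ll y_l\ll\varepsilon t_\phi$). Then in the region $\{x+iy:-\frac12<x\le\frac12,\ |y-y_l|\le\varepsilon y_lt_\phi^{-2/3}\}$ the nodal line $\{\phi=0\}$ is contained in neighbourhoods, of width tending to $0$ as $t_\phi\to\infty$, of the vertical lines $x=\frac{m}{4l}$ with $m$ odd and $|m|\le2l$.
   Context: An even Hecke–Maass cusp form is a real-valued $\phi$ on $\mathbb{H}$ with $y^2(\partial_x^2+\partial_y^2)\phi+(\frac14+t_\phi^2)\phi=0$, $t_\phi>0$, $\mathrm{SL}_2(\mathbb{Z})$-invariant, $\phi(-\bar z)=\phi(z)$, $L^2$-normalized, eigenfunction of all Hecke operators, with Fourier expansion $\phi(z)=\sum_{n\ne0}\rho_\phi(n)y^{1/2}K_{it_\phi}(2\pi|n|y)e^{2\pi inx}$ and $\rho_\phi(n)=\lambda_\phi(n)\rho_\phi(1)$, $\lambda_\phi(1)=1$ (Hecke eigenvalues). Asymptotics are as $t_\phi\to\infty$. *)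

(* Defs.v *)
From HB Require Import structures.
From mathcomp Require Export all_boot all_order all_algebra.
From mathcomp Require Export all_classical all_reals all_analysis.
From mathcomp Require Export complex.

Set Implicit Arguments.
Unset Strict Implicit.
Unset Printing Implicit Defensive.

Export Order.TTheory GRing.Theory Num.Theory.
Export numFieldNormedType.Exports.

Local Open Scope classical_set_scope.
Local Open Scope complex_scope.
Local Open Scope ring_scope.

(* Points z = x + iy of the plane are pairs (x, y) : R * R.  Functions on the
   upper half-plane are total functions on R * R whose values outside
   [upper_half_plane] are never used. *)

Definition upper_half_plane (R : realType) : set (R * R) :=
  [set z | 0 < z.2].

Definition to_complex (R : realType) (z : R * R) : R[i] := z.1 +i* z.2.

Definition of_complex (R : realType) (w : R[i]) : R * R :=
  (complex.Re w, complex.Im w).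

Definition moebius (R : realType) (g : 'M[int]_2) (z : R * R) : R * R :=
  let w := to_complex z in
  of_complex (((g 0 0)%:~R * w + (g 0 1)%:~R) /
              ((g 1 0)%:~R * w + (g 1 1)%:~R)).

Definition SL2Z_invariant (R : realType) (phi : R * R -> R) : Prop :=
  forall (g : 'M[int]_2) (z : R * R), \det g = 1 ->
    upper_half_plane z -> phi (moebius g z) = phi z.

Definition twice_continuously_differentiable (R : realType)
    (phi : R * R -> R) : Prop :=
  forall z v w : R * R, upper_half_plane z ->
    [/\ derivable phi z v,
        derivable ('D_v phi) z w &
        {for z, continuous ('D_w ('D_v phi))}].

Definition laplacian (R : realType) (phi : R * R -> R) (z : R * R) : R :=
  let ex : R * R := (1, 0) in
  let ey : R * R := (0, 1) in
  'D_ex ('D_ex phi) z + 'D_ey ('D_ey phi) z.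

(* The standard fundamental domain of SL_2(Z); the boundary is a null set. *)
Definition fundamental_domain (R : realType) : set (R * R) :=
  [set z | [/\ 0 < z.2, `|z.1| <= 1 / 2 & 1 <= z.1 ^+ 2 + z.2 ^+ 2]].

Definition L2_normalized (R : realType) (phi : R * R -> R) : Prop :=
  (\int[(@lebesgue_measure R \x @lebesgue_measure R)%E]_(z in
     @fundamental_domain R) ((phi z) ^+ 2 / z.2 ^+ 2)%R%:E = 1)%E.

(* (T_n phi)(z) = n^(-1/2) sum_(ad = n) sum_(0 <= b < d) phi((a z + b) / d),
   the normalization for which the eigenvalue of T_n is the ratio of Fourier
   coefficients rho(n) / rho(1). *)
Definition hecke (R : realType) (n : nat) (phi : R * R -> R) (z : R * R) : R :=
  (Num.sqrt n%:R)^-1 *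
  \sum_(d <- divisors n) \sum_(b < d)
     phi (((n %/ d)%N%:R * z.1 + b%:R) / d%:R, (n %/ d)%N%:R * z.2 / d%:R).

(* K_(it)(u) = int_0^oo exp(- u cosh s) cos(t s) ds, for u > 0. *)
Definition besselK_it (R : realType) (t u : R) : R :=
  Rintegral (@lebesgue_measure R) `[0, +oo[
    (fun s : R => expR (- (u * ((expR s + expR (- s)) / 2))) * cos (t * s)).

Definition fourier_term (R : realType) (t : R) (rho : int -> R[i])
    (z : R * R) (n : int) : R[i] :=
  rho n * (Num.sqrt z.2 * besselK_it t (2 * pi * `|n%:~R| * z.2))%:C
  * (cos (2 * pi * n%:~R * z.1) +i* sin (2 * pi * n%:~R * z.1)).

(* The norm of R[i] is R[i]-valued; this is the modulus as an element of R. *)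
Definition cmod (R : realType) (w : R[i]) : R := complex.Re `|w|.

(* The sum over all n <> 0 converges absolutely, with value phi z. *)
Definition has_fourier_expansion (R : realType) (phi : R * R -> R) (t : R)
    (rho : int -> R[i]) : Prop :=
  forall z : R * R, upper_half_plane z ->
    summable [set n : int | n != 0]
      (fun n => (cmod (fourier_term t rho z n))%:E) /\
    cmod (\sum_(1 <= n < N.+1)
            (fourier_term t rho z n%:Z + fourier_term t rho z (- n%:Z))
          - (phi z)%:C) @[N --> \oo] --> 0.

Record even_hecke_maass_cusp_form (R : realType) (phi : R * R -> R) (t : R)
    (rho : int -> R[i]) (lambda : int -> R) : Prop := {
  hm_spectral_gt0 : 0 < t;
  hm_smooth : twice_continuously_differentiable phi;
  hm_eigen : forall z, upper_half_plane z ->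
    z.2 ^+ 2 * laplacian phi z + (1 / 4 + t ^+ 2) * phi z = 0;
  hm_invariant : SL2Z_invariant phi;
  hm_even : forall z, upper_half_plane z -> phi (- z.1, z.2) = phi z;
  hm_normalized : L2_normalized phi;
  hm_fourier : has_fourier_expansion phi t rho;
  hm_rho : forall n : int, n != 0 -> rho n = (lambda n)%:C * rho 1;
  hm_lambda1 : lambda 1 = 1;
  hm_hecke : forall (n : nat) z, (0 < n)%N -> upper_half_plane z ->
    hecke n phi z = lambda n%:Z * phi z
}.

Definition nodal_line (R : realType) (phi : R * R -> R) : set (R * R) :=
  [set z | upper_half_plane z /\ phi z = 0].

Definition y_level (R : realType) (t : R) (l : int) : R :=
  t / (2 * pi * l%:~R).

Definition nodal_region (R : realType) (eps t : R) (l : int) : set (R * R) :=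
  [set z | - (1 / 2) < z.1 <= 1 / 2 /\
           `|z.2 - y_level t l| <= eps * y_level t l * t `^ (- (2 / 3))].

Definition vertical_strip (R : realType) (x0 w : R) : set (R * R) :=
  [set z | `|z.1 - x0| < w].

(* Main.v *)
Require Import Defs.
From mathcomp Require Import ring lra zify.
From mathcomp Require Import measurable_realfun.

(** Strips of half-width 1/(4l) around the lines x = m/(4l), m odd, cover
    everything, and the width w may depend on t only; hence large l are trivial
    and it suffices to treat each fixed l as t tends to infinity, uniformly in
    the form.

    For fixed l the term n = l dominates the Fourier expansion at height y_l.
    In the variable s = log u, the function g(s) = K_it(e^s) is the solution of
    g'' = (e^(2s) - t^2) g that decays at infinity, and only ratios to its value
    at the turning point s = log t matter.  Within t^(-2/3) of the turning point
    g stays comparable to g(log t); to the right it decays exponentially; to the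
    left the WKB quantity sqrt(Q) g^2 + g'^2 / sqrt(Q), Q = t^2 - e^(2s), is
    almost constant, so that g is smaller by a factor t^(-1/6).  The Hecke
    relations bound |lambda(n)| by n^2, because phi is bounded and not zero.
    Therefore phi = 0 forces cos(2 pi l x) to be small. *)

Set Implicit Arguments.
Unset Strict Implicit.
Unset Printing Implicit Defensive.

Local Open Scope classical_set_scope.
Local Open Scope ring_scope.

(** * The Bessel function as a solution of its differential equation *)

Section calculus.
Variable R : realType.
Implicit Types (f g : R -> R) (x a b : R).

(** The scale [k] with [k ^+ 3 = t ^+ 2] is the Airy scale of the turning point: at distance 1/k
    from log t the coefficient e^(2s) - t^2 has size about 2 k^2, so solutions vary on the length
    1/k itself. No asymptotic formula for K_it is used. Everything is compared with a = |g(log t)|,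
    which is possible because decay at infinity bounds the slope at the turning point by a multiple
    of k a. Hence a alone controls g on both sides, and a = 0 would force K_it, and with it the
    form, to vanish identically.

    The gain t^(-1/6) only has to beat constants depending on l, since l is fixed before the
    threshold for t is chosen. The same freedom permits the crude bound n^2 for the eigenvalues,
    against a factor n^(-4) taken from the Bessel decay.

    Evenness is given for phi only, and lambda(-n) is a priori unrelated to lambda(n), while the
    lower bound concerns lambda(l) alone. Uniqueness of sine series is what identifies the two. *)

Definition has_der f x a := is_derive x 1 f a.

Lemma der_eq f x a b : has_der f x a -> a = b -> has_der f x b.
Proof. by move=> d <-. Qed.

Lemma der_cst x c : has_der (fun _ : R => c : R) x 0.
Proof. exact: is_derive_cst. Qed.

Lemma der_id x : has_der (fun s : R => s) x 1.
Proof. exact: is_derive_id. Qed.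

Lemma derD f g x a b : has_der f x a -> has_der g x b ->
  has_der (fun s => f s + g s) x (a + b).
Proof. by move=> ? ?; exact: is_deriveD. Qed.

Lemma derN f x a : has_der f x a -> has_der (fun s => - f s) x (- a).
Proof. by move=> ?; exact: is_deriveN. Qed.

Lemma derM f g x a b : has_der f x a -> has_der g x b ->
  has_der (fun s => f s * g s) x (f x * b + g x * a).
Proof. by move=> ? ?; exact: is_deriveM. Qed.

Lemma der_comp (h : R -> R) f x a c : has_der f x a ->
  has_der h (f x) c -> has_der (fun s => h (f s)) x (c * a).
Proof. by move=> ? ?; apply: (@is_derive1_comp _ h f x c a). Qed.

Lemma der_exp f x a : has_der f x a ->
  has_der (fun s => expR (f s)) x (expR (f x) * a).
Proof. by move=> d; apply: (der_comp d); exact: is_derive_expR. Qed.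

Lemma der_cos f x a : has_der f x a ->
  has_der (fun s => cos (f s)) x (- sin (f x) * a).
Proof. by move=> d; apply: (der_comp d); exact: is_derive_cos. Qed.

Lemma der_sin f x a : has_der f x a ->
  has_der (fun s => sin (f s)) x (cos (f x) * a).
Proof. by move=> d; apply: (der_comp d); exact: is_derive_sin. Qed.

Lemma derX f n x a : has_der f x a ->
  has_der (fun s => f s ^+ n) x (n%:R * f x ^+ n.-1 * a).
Proof.
move=> d; elim: n => [|n IHn]; first by rewrite !mul0r; exact: der_cst.
have -> : (fun s => f s ^+ n.+1) = (fun s => f s * f s ^+ n).
  by apply/funext => s; rewrite exprS.
apply: der_eq; first exact: (derM d IHn).
case: n {IHn} => [|n] /=; rewrite -?natr1 ?exprS; ring.
Qed.

Lemma derV f x a : f x != 0 -> has_der f x a ->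
  has_der (fun s => (f s)^-1) x (- (f x) ^- 2 * a).
Proof.
move=> f0 d; have [d1 d2] := d; split; first exact: derivableV.
by rewrite deriveV // d2.
Qed.

Lemma der_sqrt f x a : 0 < f x -> has_der f x a ->
  has_der (fun s => Num.sqrt (f s)) x ((2 * Num.sqrt (f x))^-1 * a).
Proof. by move=> f0 d; apply: (der_comp d); exact: is_derive1_sqrt. Qed.

Lemma der_continuous f x a : has_der f x a -> {for x, continuous f}.
Proof. by case=> d _; exact/differentiable_continuous/derivable1_diffP. Qed.

Lemma der_mvt f (df : R -> R) a b : a <= b ->
  (forall x, a <= x <= b -> has_der f x (df x)) ->
  exists2 c, a <= c <= b & f b - f a = df c * (b - a).
Proof.
move=> ab d; have [] := @MVT_segment _ f df _ _ ab.
- by move=> x; rewrite in_itv /= => /andP[/ltW ? /ltW ?]; apply: d; apply/andP.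
- apply: derivable_within_continuous => x; rewrite in_itv /= => xab.
  by case: (d _ xab).
- by move=> c; rewrite in_itv /= => cab e; exists c.
Qed.

Lemma der_ndecr f (df : R -> R) a b : a <= b ->
  (forall x, a <= x <= b -> has_der f x (df x)) ->
  (forall x, a <= x <= b -> 0 <= df x) -> f a <= f b.
Proof.
move=> ab d df0; have [c cab e] := der_mvt ab d.
by rewrite -subr_ge0 e mulr_ge0 ?subr_ge0 ?df0.
Qed.

End calculus.

(** Differentiates by the shape of the expression; [tac] supplies the functions whose derivative is
    already known. The result fills an existential variable and is then compared with the wanted
    form through [der_eq]. *)
Ltac der_with tac :=
  repeat first [ tac | exact: der_cst | exact: der_id
   | apply: der_exp | apply: der_cos | apply: der_sin | apply: derN
   | apply: derX | apply: derD | apply: derM ].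

Section bessel.
Variables (R : realType) (t : R).
Local Notation mu := (@lebesgue_measure R).

Definition coshR (v : R) : R := (expR v + expR (- v)) / 2.
Definition sinhR (v : R) : R := (expR v - expR (- v)) / 2.

(** A family closed under d/ds that contains the integrand of K_it(e^s) as j = 0; each derivative
    only raises j. *)
Definition bker (j : nat) (s v : R) : R :=
  (expR s * coshR v) ^+ j * expR (- (expR s * coshR v)) * cos (t * v).

Lemma der_bker_s j s v :
  has_der (fun s => bker j s v) s (j%:R * bker j s v - bker j.+1 s v).
Proof.
rewrite /bker; apply: der_eq; first by der_with fail.
case: j => [|j] /=; rewrite ?exprS ?expr0; ring.
Qed.

Lemma coshR_ge v : expR v / 2 <= coshR v.
Proof. by rewrite /coshR ler_pM2r ?invr_gt0 // lerDl expR_ge0. Qed.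

Lemma coshR_gt0 v : 0 < coshR v.
Proof. by apply: lt_le_trans (coshR_ge v); rewrite divr_gt0 ?expR_gt0. Qed.

(** The term of order j + 1 of the exponential series leaves a spare factor 1/x. With x = e^s cosh v
    it provides both the e^(-v) that makes all integrals converge and the e^(-s) of
    [besselg_bound]. *)
Lemma expr_expRN j x : 0 < x -> x ^+ j * expR (- x) <= (j.+1`!%:R : R) * x^-1.
Proof.
move=> x0; rewrite expRN ler_pdivrMr ?expR_gt0 // mulrAC ler_pdivlMr // -exprSr.
rewrite -ler_pdivrMl ?ltr0n ?fact_gt0 // mulrC.
by apply: le_trans (expR_ge1Dxn j (ltW x0)); rewrite lerDr ler01.
Qed.

Lemma bker_bound j s v : `|bker j s v| <= (j.+1`!%:R * 2) * expR (- s) * expR (- v).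
Proof.
rewrite /bker; set x := expR s * _.
have x0 : 0 < x by rewrite mulr_gt0 ?expR_gt0 ?coshR_gt0.
rewrite normrM (ger0_norm (mulr_ge0 (exprn_ge0 _ (ltW x0)) (expR_ge0 _))).
apply: (@le_trans _ _ (x ^+ j * expR (- x))).
  apply: ler_piMr; first by rewrite mulr_ge0 ?expR_ge0 // exprn_ge0 // ltW.
  by rewrite ler_norml cos_geN1 cos_le1.
apply: (le_trans (expr_expRN j x0)); rewrite -!mulrA ler_pM2l ?ltr0n ?fact_gt0 //.
rewrite !expRN -invfM -[X in X * _]invrK -invfM lef_pV2 ?posrE //.
  by have := coshR_ge v; rewrite /x; have := expR_gt0 s; nra.
by rewrite mulr_gt0 ?invr_gt0 // mulr_gt0 ?expR_gt0.
Qed.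

Lemma der_coshR v : has_der coshR v (sinhR v).
Proof.
rewrite /coshR /sinhR; apply: der_eq; first by der_with fail.
by rewrite /=; ring.
Qed.

Lemma der_sinhR v : has_der sinhR v (coshR v).
Proof.
rewrite /coshR /sinhR; apply: der_eq; first by der_with fail.
by rewrite /=; ring.
Qed.

Lemma coshR_sqr v : coshR v ^+ 2 = 1 + sinhR v ^+ 2.
Proof.
rewrite /coshR /sinhR !expRN; have := expR_gt0 v; move: (expR v) => e e0.
by field; rewrite gt_eqF.
Qed.

Lemma continuous_bker j s : continuous (bker j s).
Proof.
move=> v; apply: der_continuous; rewrite /bker.
by der_with ltac:(exact: der_coshR).
Qed.

Lemma cvg_expRN0 (c : R) : c * expR (- v) @[v --> +oo] --> (0 : R).
Proof. by rewrite -(mulr0 c); apply: cvgMr; exact: cvgr_expR. Qed.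

Lemma continuous_at_right0 (f : R -> R) a : {for a, continuous f} ->
  f x @[x --> a^'+] --> f a.
Proof. by move=> h; exact: cvg_at_right_filter. Qed.

Lemma integral_expRN : (\int[mu]_(v in `[0%R, +oo[)  (expR (- v))%:E = 1%:E)%E.
Proof.
have d x : has_der (fun v : R => - expR (- v)) x (expR (- x)).
  by apply: der_eq; [der_with fail|rewrite /=; ring].
rewrite (@ge0_continuous_FTC2y _ _ (fun v => - expR (- v)) 0 0).
- by rewrite oppr0 expR0 -EFinB opprK add0r.
- by move=> x _; exact: expR_ge0.
- apply: continuous_subspaceT => x.
  apply: der_continuous; by der_with fail.
- by rewrite -oppr0; apply: cvgN; exact: cvgr_expR.
- by move=> x _; case: (d x).
- by apply: continuous_at_right0; apply: der_continuous; exact: d.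
- by move=> x _; rewrite derive1E; case: (d x).
Qed.

Lemma Rintegral_expRN : \int[mu]_(v in `[0, +oo[) expR (- v) = 1 :> R.
Proof. by rewrite /Rintegral integral_expRN. Qed.

Lemma integrable_expRN (c : R) :
  mu.-integrable `[0, +oo[ (EFin \o (fun v => c * expR (- v))).
Proof.
have m1 : measurable_fun (`[0%R, +oo[%classic : set R) (fun v : R => (expR (- v))).
  apply: measurable_funTS; apply: continuous_measurable_fun => x.
  apply: der_continuous; by der_with fail.
have -> : EFin \o (fun v => c * expR (- v)) = (fun v => c%:E * (expR (- v))%:E)%E.
  by apply/funext => v /=; rewrite EFinM.
apply: integrableZl => //.
apply/integrableP; split; first exact/measurable_EFinP.
under eq_integral do rewrite /= ger0_norm ?expR_ge0 //.
by rewrite integral_expRN ltry.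
Qed.

Lemma integrable_dominated (f : R -> R) (c : R) : continuous f ->
  (forall v, 0 <= v -> `|f v| <= c * expR (- v)) ->
  mu.-integrable `[0, +oo[ (EFin \o f).
Proof.
move=> cf fb; apply: le_integrable (integrable_expRN c) => //.
- apply/measurable_EFinP/measurable_funTS; exact: continuous_measurable_fun.
- move=> v; rewrite /= in_itv /= andbT => v0; rewrite lee_fin.
  by apply: (le_trans (fb _ v0)); exact: ler_norm.
Qed.

Lemma integrable_bker j s : mu.-integrable `[0, +oo[ (EFin \o bker j s).
Proof.
apply: integrable_dominated; first exact: continuous_bker.
by move=> v _; exact: bker_bound.
Qed.

Definition bint j s := \int[mu]_(v in `[0, +oo[) bker j s v.

Lemma der_bint j s : has_der (bint j) s (j%:R * bint j s - bint j.+1 s).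
Proof.
have -> : j%:R * bint j s - bint j.+1 s =
  \int[mu]_(v in `[0, +oo[) partial1of2 (bker j) s v.
  rewrite /bint -RintegralZl //; last exact: integrable_bker.
  rewrite -RintegralB //; [|have := @integrableZl _ _ _ mu `[0%R, +oo[ _ j%:R _ (integrable_bker j s)|exact: integrable_bker].
    apply: eq_Rintegral => v _; rewrite partial1of2E.
    by case: (der_bker_s j s v) => _ ->.
  by apply.
(* Since exp(-x) <= exp(1 - s) for x > s - 1, one multiple of e^(-v) dominates the derivative on the
   whole interval around s. *)
pose c := (j%:R * (j.+1`!%:R * 2) + j.+2`!%:R * 2) * expR (1 - s) : R.
have h := @cvg_differentiation_under_integral R _ _ mu (bker j) `[0%R, +oo[ _ s
   (s - 1) (s + 1) _ _ _ (fun v => c * expR (- v)).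
have {}h : h^-1 *: (bint j (h + s) - bint j s) @[h --> 0^'] -->
   \int[mu]_(v in `[0, +oo[) partial1of2 (bker j) s v.
  apply: h => //.
  - by rewrite /= in_itv /=; apply/andP; split; lra.
  - by move=> x _; exact: integrable_bker.
  - by move=> x v _ _; case: (der_bker_s j x v).
  - move=> v; rewrite !mulr_ge0 ?expR_ge0 //.
  - exact: integrable_expRN.
  - move=> x v; rewrite /= in_itv /= => /andP[xs _] _; rewrite partial1of2E.
    case: (der_bker_s j x v) => _ ->.
    apply: (le_trans (ler_normB _ _)); rewrite normrM.
    rewrite /c mulrDl mulrDl lerD //.
      rewrite ger0_norm ?ler0n // -!mulrA ler_wpM2l ?ler0n //.
      apply: (le_trans (bker_bound _ _ _)).
      rewrite -!mulrA !ler_wpM2l ?ler0n // ler_wpM2r ?expR_ge0 // ler_expR; lra.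
    apply: (le_trans (bker_bound _ _ _)).
    rewrite -!mulrA !ler_wpM2l ?ler0n // ler_wpM2r ?expR_ge0 // ler_expR; lra.
split.
  by apply/cvg_ex; eexists; under eq_fun do rewrite scaler1; exact: h.
by rewrite -derive1E; apply/cvg_lim.
Qed.

(* The boundary term of two integrations by parts in [v]; since
   (d/ds)^2 - (d/dv)^2 multiplies exp(- e^s cosh v) by e^(2s), integrating its
   derivative gives the modified Bessel equation. *)
Definition bparts s v : R :=
  - (expR s * sinhR v) * expR (- (expR s * coshR v)) * cos (t * v)
  + t * (expR (- (expR s * coshR v)) * sin (t * v)).

Lemma der_bparts s v : has_der (bparts s) v
  (bker 2 s v - bker 1 s v + (t ^+ 2 - expR s ^+ 2) * bker 0 s v).
Proof.
rewrite /bparts /bker; apply: der_eq.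
  by der_with ltac:(first [exact: der_coshR|exact: der_sinhR]).
by rewrite /= expr0 expr1 exprMn coshR_sqr; ring.
Qed.

Lemma sinhR_norm_le v : `|sinhR v| <= coshR v.
Proof.
have := expR_gt0 v; have := expR_gt0 (- v).
by rewrite /sinhR /coshR ler_norml => *; apply/andP; split; lra.
Qed.

Lemma bparts_bound s v :
  `|bparts s v| <= (4 + `|t| * 2) * expR (- s) * expR (- v).
Proof.
set x := expR s * coshR v.
have x0 : 0 < x by rewrite mulr_gt0 ?expR_gt0 ?coshR_gt0.
have xV : x^-1 <= 2 * expR (- s) * expR (- v).
  rewrite -mulrA !expRN -invfM -[X in X * _]invrK -invfM lef_pV2 ?posrE //.
    by have := coshR_ge v; rewrite /x; have := expR_gt0 s; nra.
  by rewrite mulr_gt0 ?invr_gt0 // mulr_gt0 ?expR_gt0.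
have h1 := expr_expRN 1 x0; have h0 := expr_expRN 0 x0.
rewrite expr1 (_ : (2`!)%N = 2%N) // in h1; rewrite expr0 (_ : (1`!)%N = 1%N) // in h0.
have e0 := expR_gt0 (- x).
apply: (@le_trans _ _ (x * expR (- x) + `|t| * expR (- x))); last first.
  rewrite !mulrDl lerD //; first by nra.
  rewrite -!mulrA ler_wpM2l //; nra.
rewrite /bparts; apply: (le_trans (ler_normD _ _)); apply: lerD.
  rewrite -/x normrM -[leRHS]mulr1 ler_pM //; last first.
    by rewrite ler_norml cos_geN1 cos_le1.
  rewrite normrM (ger0_norm (ltW e0)) normrN normrM.
  rewrite ler_wpM2r ?(ltW e0) //.
  rewrite /x (ger0_norm (expR_ge0 _)) ler_pM2l ?expR_gt0 //.
  exact: sinhR_norm_le.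
rewrite normrM ler_wpM2l // normrM ger0_norm ?expR_ge0 // -[leRHS]mulr1.
by rewrite ler_wpM2l ?expR_ge0 // ler_norml sin_geN1 sin_le1.
Qed.

Lemma cvg0_expRN_bound (f : R -> R) (c : R) :
  (forall v, 0 <= v -> `|f v| <= c * expR (- v)) -> f v @[v --> +oo] --> (0 : R).
Proof.
move=> fb; apply: norm_cvg0.
apply: (squeeze_cvgr _ (cvg_cst 0) (cvg_expRN0 c)).
near=> v; rewrite normr_ge0 /=; apply: fb.
by near: v; apply: nbhs_pinfty_ge; rewrite num_real.
Unshelve. all: by end_near. Qed.

(** Adding c e^(-v) makes the integrand nonnegative, so that the fundamental theorem on the
    half-line applies to the primitive H - c e^(-v); the added part integrates to c and cancels. *)
Lemma Rintegral_derive0 (H h : R -> R) (c : R) :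
  (forall v, has_der H v (h v)) -> continuous h -> H 0 = 0 ->
  (forall v, 0 <= v -> `|H v| <= c * expR (- v)) ->
  (forall v, 0 <= v -> `|h v| <= c * expR (- v)) ->
  \int[mu]_(v in `[0, +oo[) h v = 0.
Proof.
move=> dH ch H0 Hb hb.
have iE := integrable_expRN c; have ih := integrable_dominated ch hb.
have d x : has_der (fun v : R => H v - c * expR (- v)) x (h x + c * expR (- x)).
  apply: der_eq; first by der_with ltac:(exact: dH).
  by rewrite /=; ring.
have e : \int[mu]_(v in `[0, +oo[) (h v + c * expR (- v)) = c.
  rewrite (@Rintegral_ge0_continuous_FTC2y _ _ (fun v => H v - c * expR (- v)) 0 0).
  - by rewrite H0 oppr0 expR0; ring.
  - by move=> x x0; have := hb x x0; rewrite ler_norml => /andP[]; lra.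
  - apply: continuous_subspaceT => x.
    apply: (@continuousD _ _ _ h (fun x => c * expR (- x))); first exact: ch.
    by apply: der_continuous; der_with fail.
  - rewrite -(subr0 (0:R)); apply: cvgB; last exact: cvg_expRN0.
    exact: cvg0_expRN_bound Hb.
  - by move=> x _; case: (d x).
  - by apply: continuous_at_right0; apply: der_continuous; exact: d.
  - by move=> x _; rewrite derive1E; case: (d x).
have iE1 := integrable_expRN 1.
move: e; rewrite RintegralD // RintegralZl //; last first.
  by move: iE1; rewrite (_ : (fun v => 1 * expR (- v)) = (fun v => expR (- v))) //;
    apply/funext => v; rewrite mul1r.
rewrite Rintegral_expRN; lra.
Qed.

(** The left side is the second derivative of [bint 0], so this is the modified Bessel equation in
    the variable s = log u. *)
Lemma bint_ode s :
  bint 2 s - bint 1 s = (expR s ^+ 2 - t ^+ 2) * bint 0 s.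
Proof.
pose h v := bker 2 s v - bker 1 s v + (t ^+ 2 - expR s ^+ 2) * bker 0 s v.
have i2 := integrable_bker 2 s; have i1 := integrable_bker 1 s.
have i0 := integrable_bker 0 s.
pose q : R := `|t ^+ 2 - expR s ^+ 2|.
(* One constant for two bounds: 4 + 2|t| for [bparts], and 12 + 4 + 2q for its derivative. *)
pose c : R := (20 + `|t| * 2 + 2 * q) * expR (- s).
have h0 : \int[mu]_(v in `[0, +oo[) h v = 0.
  apply: (@Rintegral_derive0 (bparts s) h c).
  - exact: der_bparts.
  - move=> v; rewrite /h.
    apply: (@continuousD _ _ _ (fun v => bker 2 s v - bker 1 s v)
      (fun v => (t ^+ 2 - expR s ^+ 2) * bker 0 s v)).
      by apply: (@continuousB _ _ _ (bker 2 s) (bker 1 s)); exact: continuous_bker.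
    apply: (@continuousM _ _ (cst (t ^+ 2 - expR s ^+ 2)) (bker 0 s)).
      exact: cvg_cst.
    exact: continuous_bker.
  - by rewrite /bparts /sinhR oppr0 subrr (mulr0 t) sin0; ring.
  - move=> v v0; apply: (le_trans (bparts_bound s v)); rewrite /c.
    rewrite ler_wpM2r ?expR_ge0 // ler_wpM2r ?expR_ge0 //.
    by have : 0 <= q := normr_ge0 _; lra.
  - move=> v v0; rewrite /h.
    apply: (le_trans (ler_normD _ _)); rewrite normrM -/q.
    have := ler_normB (bker 2 s v) (bker 1 s v).
    have := bker_bound 2 s v; have := bker_bound 1 s v; have := bker_bound 0 s v.
    rewrite (_ : (3`!)%N = 6%N) // (_ : (2`!)%N = 2%N) // (_ : (1`!)%N = 1%N) //.
    rewrite /c -!mulrA; set E := expR (- s) * expR (- v).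
    have E0 : 0 <= E by rewrite mulr_ge0 ?expR_ge0.
    have q0 : 0 <= q := normr_ge0 _.
    have t0 : 0 <= `|t| := normr_ge0 _.
    move=> b0 b1 b2 b3.
    have : q * `|bker 0 s v| <= q * (1 * (2 * E)) by apply: ler_wpM2l.
    have : 0 <= `|t| * E by apply: mulr_ge0.
    move: b0 b1 b2 b3; lra.
have iz : mu.-integrable `[0, +oo[ (EFin \o (fun v => (t ^+ 2 - expR s ^+ 2) * bker 0 s v)).
  have := @integrableZl _ _ _ mu `[0%R, +oo[%classic _ (t ^+ 2 - expR s ^+ 2) _ i0.
  by apply.
have i21 : mu.-integrable `[0, +oo[ (EFin \o (fun v => bker 2 s v - bker 1 s v)).
  by have := integrableB _ i2 i1; apply.
move: h0; rewrite /h RintegralD // RintegralB // RintegralZl // -/(bint 2 s) -/(bint 1 s).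
rewrite -/(bint 0 s); lra.
Qed.

Definition besselg (s : R) := besselK_it t (expR s).
Definition besselg1 (s : R) := - bint 1 s.

Lemma besselgE : besselg = bint 0.
Proof.
apply/funext => s; rewrite /besselg /besselK_it /bint; apply: eq_Rintegral => v _.
by rewrite /bker expr0 mul1r.
Qed.

Lemma der_besselg s : has_der besselg s (besselg1 s).
Proof.
by rewrite besselgE /besselg1; apply: der_eq (der_bint 0 s) _; rewrite mul0r add0r.
Qed.

Lemma der_besselg1 s :
  has_der besselg1 s ((expR s ^+ 2 - t ^+ 2) * besselg s).
Proof.
rewrite besselgE -bint_ode /besselg1; apply: der_eq; first exact/derN/der_bint.
by rewrite mul1r; ring.
Qed.

Lemma besselg_bound s : `|besselg s| <= 2 * expR (- s).
Proof.
rewrite besselgE /bint; apply: (le_trans (le_normr_Rintegral _ _)) => //.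
  exact: integrable_bker.
have -> : 2 * expR (- s) = \int[mu]_(v in `[0, +oo[) (2 * expR (- s) * expR (- v)).
  have iE1 := integrable_expRN 1.
  rewrite RintegralZl //; first by rewrite Rintegral_expRN mulr1.
  by move: iE1; rewrite (_ : (fun v => 1 * expR (- v)) = (fun v => expR (- v))) //;
    apply/funext => v; rewrite mul1r.
apply: le_Rintegral => //.
- by have /integrable_norm := integrable_bker 0 s.
- exact: integrable_expRN.
- by move=> v _; have := bker_bound 0 s v; rewrite (_ : (1`!)%N = 1%N) // mul1r.
Qed.

End bessel.

(** * Decaying solutions near the turning point *)

Section elementary.
Variable R : realType.

Lemma expR_le_inv (y : R) : y < 1 -> expR y <= (1 - y)^-1.
Proof.
move=> y1; rewrite -[leLHS]invrK lef_pV2 ?posrE ?invr_gt0 ?expR_gt0 ?subr_gt0 //.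
by rewrite -expRN; have := expR_ge1Dx (- y).
Qed.

Lemma expR_sub1_le (y : R) : 0 <= y <= 1 / 2 -> expR y - 1 <= 2 * y.
Proof.
move=> /andP[y0 y1]; have y2 : y < 1 by lra.
have := expR_le_inv y2; have z0 : 0 < 1 - y by lra.
rewrite -[X in expR y <= X]mul1r ler_pdivlMr // => h.
by have := expR_gt0 y; nra.
Qed.

Lemma sub1_expRN_ge (y : R) : 0 <= y <= 1 -> y / 2 <= 1 - expR (- y).
Proof.
move=> /andP[y0 y1]; have y2 : - y < 1 by lra.
have := expR_le_inv y2; have z0 : 0 < 1 - - y by lra.
rewrite -[X in expR (- y) <= X]mul1r ler_pdivlMr // => h.
by have := expR_gt0 (- y); nra.
Qed.

Lemma expR_le4 (y : R) : y <= 1 -> expR y <= 4.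
Proof.
move=> y1; apply: (@le_trans _ _ (expR (1 / 2) ^+ 2)).
  by rewrite -expRM_natl ler_expR; lra.
have h : (1 / 2 : R) < 1 by lra.
have := expR_le_inv h; rewrite (_ : (1 - 1 / 2)^-1 = 2) => [h2|]; last by field.
by have := expR_gt0 (1 / 2 : R); nra.
Qed.

End elementary.

Section bessel_ode.
Variables (R : realType) (t : R) (g g1 : R -> R).
Hypothesis t0 : 0 < t.
Hypothesis dg : forall s, has_der g s (g1 s).
Hypothesis dg1 : forall s, has_der g1 s ((expR s ^+ 2 - t ^+ 2) * g s).
Hypothesis gb : forall s, `|g s| <= 2 * expR (- s).

Local Ltac der := der_with ltac:(first [exact: dg|exact: dg1]).

(** X = g g' + k g^2 satisfies X' >= (g' + k g)^2 >= 0, so a positive value persists to the right.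
    As 2 X e^(2ks) is the derivative of g^2 e^(2ks), g^2 would then stay bounded below, against the
    decay [gb]. This is where the growing solutions are excluded. *)
Lemma ode_logder_le0 k s0 : 0 <= k -> t ^+ 2 + k ^+ 2 <= expR s0 ^+ 2 ->
  forall s, s0 <= s -> g s * g1 s + k * g s ^+ 2 <= 0.
Proof.
move=> k0 hk a s0a; rewrite leNgt; apply/negP => X0.
pose X s := g s * g1 s + k * g s ^+ 2.
have exs s : s0 <= s -> t ^+ 2 + k ^+ 2 <= expR s ^+ 2.
  move=> h; apply: (le_trans hk); rewrite lerXn2r ?nnegrE ?expR_ge0 //.
  by rewrite ler_expR.
have dX s : has_der X s (g1 s ^+ 2 + (expR s ^+ 2 - t ^+ 2) * g s ^+ 2
    + 2 * k * g s * g1 s).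
  rewrite /X; apply: der_eq; first by der.
  by rewrite /=; ring.
have Xa b : a <= b -> X a <= X b.
  move=> ab; apply: (der_ndecr ab (fun s _ => dX s)) => s /andP[as_ _].
  have := exs s (le_trans s0a as_); have := sqr_ge0 (g1 s + k * g s).
  by have := sqr_ge0 (g s); nra.
(* This b makes X(a) e^(-2k) b > 1, whereas the decay at b will give X(a) e^(-2k) (1 + b)^2 <= 2. *)
pose b := `|a| + 1 + expR (2 * k) / X a.
have eX : 0 < expR (2 * k) / X a by rewrite divr_gt0 // expR_gt0.
have ab : a <= b - 1 by have := ler_norm a; rewrite /b; lra.
have b0 : 0 < b by have := normr_ge0 a; rewrite /b; lra.
have dP s : has_der (fun s => g s ^+ 2 * expR (2 * k * (s - b))) s
    (2 * X s * expR (2 * k * (s - b))).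
  rewrite /X; apply: der_eq; first by der.
  by rewrite /=; ring.
have bb : b - 1 <= b by lra.
have [c /andP[c1 c2]] := der_mvt bb (fun s _ => dP s).
rewrite (_ : b - (b - 1) = 1) ?mulr1; last by ring.
rewrite subrr mulr0 expR0 mulr1 => e.
have h1 : X a * expR (- (2 * k)) <= X c * expR (2 * k * (c - b)).
  apply: ler_pM; rewrite ?expR_ge0 ?(ltW X0) //.
    by apply: Xa; lra.
  by rewrite ler_expR; nra.
have h2 : 2 * X a * expR (- (2 * k)) <= g b ^+ 2.
  have := mulr_ge0 (sqr_ge0 (g (b - 1))) (expR_ge0 (2 * k * (b - 1 - b))).
  by move: e h1; lra.
have h3 : g b ^+ 2 <= 4 * expR (- b) ^+ 2.
  have := gb b; rewrite -[g b ^+ 2]real_normK ?num_real //.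
  have := normr_ge0 (g b); nra.
have h4 : expR (- b) * (1 + b) <= 1.
  have := expR_ge1Dx b; have := expRxMexpNx_1 b; have := expR_gt0 (- b); nra.
have h5 : expR (- (2 * k)) * expR (2 * k) = 1.
  by rewrite mulrC expRxMexpNx_1.
have h6 : expR (2 * k) / X a < b by have := normr_ge0 a; rewrite /b; lra.
have h7 : expR (2 * k) < b * X a by rewrite -ltr_pdivrMr.
have h8 : expR (- b) ^+ 2 * (1 + b) ^+ 2 <= 1.
  by rewrite -exprMn; have := mulr_ge0 (expR_ge0 (- b)) (ltW (ltr_pwDl ltr01 (ltW b0))); nra.
have h9 : X a * expR (- (2 * k)) * (1 + b) ^+ 2 <= 2.
  have : X a * expR (- (2 * k)) <= 2 * expR (- b) ^+ 2 by lra.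
  by move=> h; have := ler_wpM2r (sqr_ge0 (1 + b)) h; lra.
have : 1 < X a * expR (- (2 * k)) * b.
  have : expR (- (2 * k)) * expR (2 * k) < expR (- (2 * k)) * (b * X a).
    by rewrite ltr_pM2l ?expR_gt0.
  by rewrite h5; lra.
have : 0 < X a * expR (- (2 * k)) by rewrite mulr_gt0 ?expR_gt0.
move: h9; set y := X a * _ => h9 y0 y1.
have : 0 < y * b ^+ 2 by rewrite mulr_gt0 // exprn_gt0.
by move: h9; rewrite sqrrD; lra.
Qed.

(** The sign of the logarithmic derivative makes g^2 e^(2ks) nonincreasing. The rate k = 0 is
    allowed at the turning point itself and gives [g_le_right]. *)
Lemma ode_decay k s0 : 0 <= k -> t ^+ 2 + k ^+ 2 <= expR s0 ^+ 2 ->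
  forall s, s0 <= s -> `|g s| <= `|g s0| * expR (- (k * (s - s0))).
Proof.
move=> k0 hk s s0s.
have dP s' : has_der (fun s => - (g s ^+ 2 * expR (2 * k * (s - s0)))) s'
    (- (2 * (g s' * g1 s' + k * g s' ^+ 2) * expR (2 * k * (s' - s0)))).
  apply: der_eq; first by der.
  by rewrite /=; ring.
have := der_ndecr s0s (fun s _ => dP s).
rewrite subrr mulr0 expR0 mulr1 => h.
have {}h : g s ^+ 2 * expR (2 * k * (s - s0)) <= g s0 ^+ 2.
  rewrite -lerN2; apply: h => x /andP[sx _]; rewrite -mulNr mulr_ge0 ?expR_ge0 //.
  by have := ode_logder_le0 k0 hk sx; lra.
rewrite -[leLHS](mulfK (lt0r_neq0 (expR_gt0 (k * (s - s0))))) expRN.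
rewrite ler_wpM2r ?invr_ge0 ?expR_ge0 //.
rewrite -(ler_pXn2r (n:=2)) ?nnegrE ?mulr_ge0 ?expR_ge0 //.
rewrite exprMn !real_normK ?num_real // -expRM_natl.
by rewrite (_ : 2%:R * (k * (s - s0)) = 2 * k * (s - s0)) //; ring.
Qed.

Definition energy k s := g1 s ^+ 2 + k ^+ 2 * g s ^+ 2.

(** With Q = t^2 - e^(2s), the derivative of [energy k] is 2 (k^2 - Q) g g'. Since |k^2 - Q| <= k^2
    and 2 k |g g'| <= [energy k], it is at least -k times the energy, so bounds propagate from b
    back to a. *)
Lemma energy_gronwall k a b : 0 < k -> a <= b ->
  (forall s, a <= s <= b -> 0 <= t ^+ 2 - expR s ^+ 2 <= 2 * k ^+ 2) ->
  energy k a <= energy k b * expR (k * (b - a)).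
Proof.
move=> k0 ab hQ.
have dN s : has_der (fun s => energy k s * expR (k * (s - a))) s
  (expR (k * (s - a)) * (k * energy k s
    + 2 * (k ^+ 2 - (t ^+ 2 - expR s ^+ 2)) * (g s * g1 s))).
  rewrite /energy; apply: der_eq; first by der.
  by rewrite /=; ring.
have := der_ndecr ab (fun s _ => dN s); rewrite subrr mulr0 expR0 mulr1; apply.
move=> s /hQ; set Q := t ^+ 2 - _ => /andP[Q0 Q1].
rewrite mulr_ge0 ?expR_ge0 // /energy.
have h1 := sqr_ge0 (g1 s + k * g s); have h2 := sqr_ge0 (g1 s - k * g s).
have k2 : 0 < k ^+ 2 by rewrite exprn_gt0.
suff : 0 <= k * (k * (g1 s ^+ 2 + k ^+ 2 * g s ^+ 2) + 2 * (k ^+ 2 - Q) * (g s * g1 s)).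
  by rewrite pmulr_rge0.
have -> : k * (k * (g1 s ^+ 2 + k ^+ 2 * g s ^+ 2) + 2 * (k ^+ 2 - Q) * (g s * g1 s)) =
  (k ^+ 2 - Q / 2) * (g1 s + k * g s) ^+ 2 + (Q / 2) * (g1 s - k * g s) ^+ 2.
  by field.
by rewrite addr_ge0 // mulr_ge0 //; lra.
Qed.

(** Uniqueness for the initial value problem: [energy_gronwall] with k = t applies on the whole left
    half-line, where 0 <= Q <= t^2. *)
Lemma ode_zero_left : g (ln t) = 0 -> g1 (ln t) = 0 ->
  forall s, s <= ln t -> g s = 0.
Proof.
move=> e0 e1 s st.
have := @energy_gronwall t s (ln t) t0 st; rewrite {2}/energy e0 e1.
rewrite expr0n /= mulr0 addr0 mul0r => h.
have {}h : energy t s <= 0.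
  apply: h => x /andP[_ xt]; have : expR x <= t.
    by rewrite -[leRHS]lnK ?posrE // ler_expR.
  by have := expR_gt0 x; move=> *; apply/andP; split; nra.
have t2 : 0 < t ^+ 2 by rewrite exprn_gt0.
have : g s ^+ 2 <= 0.
  by rewrite -(pmulr_rle0 _ t2); move: h; rewrite /energy; have := sqr_ge0 (g1 s); lra.
by move=> h2; apply/eqP; rewrite -sqrf_eq0 eq_le h2 sqr_ge0.
Qed.

(** * Comparison with the value at the turning point, at the scale k = t^(2/3) *)

Section turning_point.
Variable k : R.
Hypothesis k4 : 4 <= k.
Hypothesis k3 : k ^+ 3 = t ^+ 2.

Let k0 : 0 < k. Proof. by apply: lt_le_trans k4. Qed.

Let kV : 0 < k^-1. Proof. by rewrite invr_gt0. Qed.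

Let kVk : k * k^-1 = 1. Proof. by rewrite mulfV // gt_eqF. Qed.

Let kVle : k^-1 <= 1 / 4.
Proof. by have := kVk; have := kV; have := k4; nra. Qed.

Lemma expR_sqr_lnD x : expR (ln t + x) ^+ 2 = t ^+ 2 * expR (2 * x).
Proof. by rewrite expRD lnK ?posrE // exprMn -expRM_natl. Qed.

Let a : R := `|g (ln t)|.

Let a0 : 0 <= a. Proof. exact: normr_ge0. Qed.

Local Ltac kfacts := have k0' := k0; have kV' := kV; have kVle' := kVle;
  have a0' := a0; have kVk' := kVk.

Lemma g_le_right s : ln t <= s -> `|g s| <= a.
Proof.
move=> h; have := @ode_decay 0 (ln t) (lexx _).
rewrite expr0n addr0 lnK ?posrE // => /(_ (lexx _) _ h).
by rewrite mul0r oppr0 expR0 mulr1.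
Qed.

(** On this window |g''| <= t^2 (4/k) a, and the window has length 1/k; the product is 4 k a because
    t^2 = k^3. *)
Lemma g1_right s : ln t <= s <= ln t + k^-1 ->
  `|g1 s - g1 (ln t)| <= 4 * k * a.
Proof.
kfacts.
move=> /andP[s1 s2]; have [c /andP[c1 c2] ->] := der_mvt s1 (fun s _ => dg1 s).
have [x xE] : exists x, c = ln t + x by exists (c - ln t); ring.
have x0 : 0 <= x by lra.
have x1 : x <= k^-1 by lra.
rewrite xE expR_sqr_lnD -xE !normrM.
have -> : t ^+ 2 * expR (2 * x) - t ^+ 2 = t ^+ 2 * (expR (2 * x) - 1) by ring.
have hx : 0 <= 2 * x <= 1 / 2 by apply/andP; split; lra.
have h1 := expR_sub1_le hx.
have h0 : 0 <= expR (2 * x) - 1 by have := expR_ge1Dx (2 * x); lra.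
have n1 : `|t ^+ 2 * (expR (2 * x) - 1)| = t ^+ 2 * (expR (2 * x) - 1).
  by rewrite ger0_norm // mulr_ge0 ?sqr_ge0.
have n2 : `|s - ln t| = s - ln t by rewrite ger0_norm // subr_ge0.
rewrite n1 n2.
have h2 := g_le_right c1; have h3 := normr_ge0 (g c).
apply: (@le_trans _ _ (t ^+ 2 * (4 * k^-1) * a * k^-1)).
  have A0 : 0 <= t ^+ 2 * (expR (2 * x) - 1) by rewrite mulr_ge0 ?sqr_ge0.
  have A1 : t ^+ 2 * (expR (2 * x) - 1) <= t ^+ 2 * (4 * k^-1).
    by apply: ler_wpM2l; rewrite ?sqr_ge0 //; lra.
  apply: (ler_pM (mulr_ge0 A0 h3) _ (ler_pM A0 h3 A1 h2)); lra.
rewrite -k3 le_eqVlt; apply/orP; left; apply/eqP.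
by field; rewrite gt_eqF.
Qed.

(** Since |g| <= a on the right, some slope within the window is at most 2a over the length 1/k,
    that is 2 k a; [g1_right] carries it back to log t at the cost of 4 k a. *)
Lemma g1_turning : `|g1 (ln t)| <= 6 * k * a.
Proof.
kfacts.
have h : ln t <= ln t + k^-1 by lra.
have [c /andP[c1 c2]] := der_mvt h (fun s _ => dg s).
rewrite (_ : ln t + k^-1 - ln t = k^-1); last by ring.
move=> e; have hc : ln t <= c <= ln t + k^-1 by apply/andP.
have h1 := g1_right hc; have h2 := g_le_right h.
have {}e : g1 c = k * (g (ln t + k^-1) - g (ln t)).
  by rewrite e mulrCA kVk mulr1.
have h3 : `|g1 c| <= 2 * k * a.
  rewrite e normrM gtr0_norm // mulrAC [_ * k]mulrC ler_pM2l //.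
  by apply: (le_trans (ler_normB _ _)); rewrite -/a; lra.
have -> : g1 (ln t) = g1 c - (g1 c - g1 (ln t)) by ring.
by apply: (le_trans (ler_normB _ _)); lra.
Qed.

(** At log t the energy is at most (6^2 + 1) k^2 a^2. Over a length 1/k it grows by at most e <= 4,
    and 37 * 4 = 148. *)
Lemma energy_left s : ln t - k^-1 <= s <= ln t -> energy k s <= 148 * k ^+ 2 * a ^+ 2.
Proof.
kfacts.
move=> /andP[s1 s2].
have hQ x : s <= x <= ln t -> 0 <= t ^+ 2 - expR x ^+ 2 <= 2 * k ^+ 2.
  move=> /andP[x1 x2].
  have [y yE] : exists y, x = ln t + - y by exists (ln t - x); ring.
  have h1 : 0 <= y by lra.
  have h2 : y <= k^-1 by lra.
  rewrite yE expR_sqr_lnD -k3.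
  have h3 : expR (2 * - y) <= 1 by rewrite expR_le1; lra.
  have h4 := expR_ge1Dx (2 * - y).
  have k33 : 0 < k ^+ 3 by rewrite exprn_gt0.
  apply/andP; split; first by nra.
  have -> : 2 * k ^+ 2 = k ^+ 3 * (2 * k^-1) by field; rewrite gt_eqF.
  have -> : k ^+ 3 - k ^+ 3 * expR (2 * - y) = k ^+ 3 * (1 - expR (2 * - y)) by ring.
  by rewrite ler_pM2l //; lra.
apply: (le_trans (energy_gronwall k0 s2 hQ)).
have h1 : expR (k * (ln t - s)) <= 4.
  by apply: expR_le4; rewrite -kVk ler_pM2l //; lra.
have h2 : energy k (ln t) <= 37 * k ^+ 2 * a ^+ 2.
  rewrite /energy -[g1 _ ^+ 2]real_normK ?num_real // -[g _ ^+ 2]real_normK ?num_real //.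
  rewrite -/a; have h := g1_turning.
  have : `|g1 (ln t)| ^+ 2 <= (6 * k * a) ^+ 2.
    by rewrite lerXn2r ?nnegrE // !mulr_ge0 // ltW.
  by rewrite !exprMn; lra.
have h3 : 0 <= energy k (ln t) by exact: addr_ge0 (sqr_ge0 _) (mulr_ge0 (sqr_ge0 _) (sqr_ge0 _)).
apply: (@le_trans _ _ (37 * k ^+ 2 * a ^+ 2 * 4)); last by lra.
by apply: ler_pM; rewrite ?expR_ge0.
Qed.

(** On the left 148 < 13^2; on the right 6 + 4 is enough. *)
Lemma g1_near s : `|s - ln t| <= k^-1 -> `|g1 s| <= 13 * k * a.
Proof.
kfacts.
rewrite ler_norml => /andP[s1 s2].
have ka : 0 <= k * a by rewrite mulr_ge0 // ltW.
have [st|st] := leP s (ln t).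
  have h : ln t - k^-1 <= s <= ln t by apply/andP; split; lra.
  have := energy_left h; rewrite /energy => h1.
  rewrite -(ler_pXn2r (n:=2)) ?nnegrE //; last by nra.
  rewrite real_normK ?num_real //.
  have : 0 <= k ^+ 2 * g s ^+ 2 by rewrite mulr_ge0 ?sqr_ge0.
  by have := sqr_ge0 (k * a); rewrite !exprMn; lra.
have h : ln t <= s <= ln t + k^-1 by apply/andP; split; lra.
have h1 := g1_right h; have h2 := g1_turning.
have -> : g1 s = (g1 s - g1 (ln t)) + g1 (ln t) by ring.
by apply: (le_trans (ler_normD _ _)); lra.
Qed.

(** The radius is chosen so that slope times distance is at most 13/50 of a, below one half. *)
Lemma g_near_ge s : `|s - ln t| <= k^-1 / 50 -> a / 2 <= `|g s|.
Proof.
kfacts.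
move=> hs.
have near x : `|x - ln t| <= `|s - ln t| -> `|g1 x| <= 13 * k * a.
  by move=> h; apply: g1_near; apply: (le_trans h); apply: (le_trans hs); lra.
have : `|g s - g (ln t)| <= 13 * k * a * `|s - ln t|.
  have [st|/ltW st] := leP s (ln t).
    have [c /andP[c1 c2] e] := der_mvt st (fun s _ => dg s).
    rewrite distrC e (distrC s) normrM ler_wpM2r //; apply: near.
    by rewrite distrC (distrC s) !ger0_norm ?subr_ge0 //; lra.
  have [c /andP[c1 c2] e] := der_mvt st (fun s _ => dg s).
  rewrite e normrM ler_wpM2r //; apply: near.
  by rewrite !ger0_norm ?subr_ge0 //; lra.
move=> h; have h2 : 13 * k * a * `|s - ln t| <= 13 / 50 * a.
  have -> : 13 / 50 * a = 13 * k * a * (k^-1 / 50) by field; rewrite gt_eqF.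
  by rewrite ler_wpM2l // !mulr_ge0 // ltW.
have := ler_normB (g s) (g s - g (ln t)).
by rewrite (_ : g s - (g s - g (ln t)) = g (ln t)) -/a; [lra|ring].
Qed.

(** When the value vanishes, [g1_turning] kills the slope too, so both initial data are zero. *)
Lemma g_turning_eq0 : g (ln t) = 0 -> forall s, g s = 0.
Proof.
move=> e s.
have e1 : g1 (ln t) = 0.
  have := g1_turning; rewrite /a e normr0 mulr0 => h.
  by apply/eqP; rewrite -normr_eq0 eq_le h normr_ge0.
have [st|/ltW st] := leP s (ln t); first exact: ode_zero_left.
have := g_le_right st; rewrite /a e normr0 => h.
by apply/eqP; rewrite -normr_eq0 eq_le h normr_ge0.
Qed.

(** * WKB estimate on the oscillatory side *)

Definition wkbq s := Num.sqrt (t ^+ 2 - expR s ^+ 2).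
Definition wkbF s := wkbq s * g s ^+ 2 + g1 s ^+ 2 / wkbq s.
(** Writing q for [wkbq], this is -q'/q^2, the relative variation of the frequency over one
    oscillation. The equation gives F' = p (g g')' for F = [wkbF] and p = [wkbp], which is the
    origin of the correction in [wkbG]. *)
Definition wkbp s := expR s ^+ 2 / wkbq s ^+ 3.
Definition wkbG s := wkbF s - wkbp s * (g s * g1 s).

Lemma wkbq_ge s : s <= ln t - k^-1 -> k <= wkbq s.
Proof.
kfacts.
move=> s1; rewrite -[leLHS]ger0_norm ?(ltW k0) // -sqrtr_sqr /wkbq ler_wsqrtr //.
apply: (@le_trans _ _ (t ^+ 2 - expR (ln t - k^-1) ^+ 2)); last first.
  rewrite lerB // lerXn2r ?nnegrE ?expR_ge0 //.
  by rewrite ler_expR.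
rewrite expR_sqr_lnD -k3.
have h : 0 <= 2 * k^-1 <= 1 by apply/andP; split; lra.
have := sub1_expRN_ge h; rewrite -mulrN => h2.
have -> : k ^+ 3 - k ^+ 3 * expR (2 * - k^-1) = k ^+ 3 * (1 - expR (2 * - k^-1)) by ring.
have -> : k ^+ 2 = k ^+ 3 * k^-1 by field; rewrite gt_eqF.
by rewrite ler_pM2l ?exprn_gt0 //; lra.
Qed.

Lemma wkbq_gt0 s : s <= ln t - k^-1 -> 0 < wkbq s.
Proof. by move/wkbq_ge; apply: lt_le_trans. Qed.

Lemma der_wkbq s : s <= ln t - k^-1 -> has_der wkbq s (- (expR s ^+ 2 / wkbq s)).
Proof.
move=> s1; have q0 := wkbq_gt0 s1; rewrite /wkbq; apply: der_eq.
  apply: der_sqrt; last by der.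
  by move: q0; rewrite /wkbq sqrtr_gt0.
by rewrite -/(wkbq s) /=; field; rewrite gt_eqF.
Qed.

(** At distance 1/k from the turning point q has already reached k, and t^2 = k^3. So the WKB regime
    starts exactly where the window of [energy_left] ends. *)
Lemma wkbp_ge0_le1 s : s <= ln t - k^-1 -> 0 <= wkbp s <= 1.
Proof.
kfacts.
move=> s1; have q0 := wkbq_gt0 s1; rewrite /wkbp; apply/andP; split.
  by rewrite divr_ge0 ?sqr_ge0 // exprn_ge0 // ltW.
rewrite ler_pdivrMr ?exprn_gt0 // mul1r.
apply: (@le_trans _ _ (k ^+ 3)); last first.
  by rewrite lerXn2r ?nnegrE ?(ltW k0) ?(ltW q0) // wkbq_ge.
rewrite k3 lerXn2r ?nnegrE ?expR_ge0 ?(ltW t0) //.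
by rewrite -[leRHS]lnK ?posrE // ler_expR; lra.
Qed.

Lemma wkbF_ge s : s <= ln t - k^-1 -> 2 * `|g s * g1 s| <= wkbF s.
Proof.
move=> s1; have q0 := wkbq_gt0 s1; rewrite /wkbF.
rewrite -subr_ge0.
have h (x : R) : `|x| = 1 -> 0 <= wkbq s * g s ^+ 2 + g1 s ^+ 2 / wkbq s + 2 * (x * (g s * g1 s)).
  move=> x1; have x2 : x ^+ 2 = 1 by rewrite -real_normK ?num_real // x1 expr1n.
  rewrite -[X in _ + X * _ + _]mul1r -{1}x2.
  have -> : wkbq s * g s ^+ 2 + x ^+ 2 * g1 s ^+ 2 / wkbq s + 2 * (x * (g s * g1 s))
    = (wkbq s * g s + x * g1 s) ^+ 2 / wkbq s by field; rewrite gt_eqF.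
  by rewrite divr_ge0 ?sqr_ge0 // ltW.
have h1 := h 1 (normr1 _); have h2 := h (- 1) (normrN1 _).
by case: (ler0P (g s * g1 s)) => _; lra.
Qed.

(* The oscillating part of [wkbF]' is a total derivative up to the slowly
   varying factor [wkbp]; subtracting it leaves an error controlled by [wkbp]'. *)
Lemma wkbG_monotone s : s <= ln t - k^-1 ->
  wkbG s * expR (wkbp s) <= wkbG (ln t - k^-1) * expR (wkbp (ln t - k^-1)).
Proof.
kfacts.
move=> s1.
pose p1 x := 2 * expR x ^+ 2 / wkbq x ^+ 3 + 3 * expR x ^+ 4 / wkbq x ^+ 5.
have dp x : x <= ln t - k^-1 -> has_der wkbp x (p1 x).
  move=> x1; have q0 := wkbq_gt0 x1; rewrite /wkbp /p1; apply: der_eq.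
    apply: derM; first by der.
    by apply: derV; [rewrite expf_neq0 // gt_eqF|apply: derX; exact: der_wkbq].
  by rewrite /=; field; rewrite gt_eqF.
have dG x : x <= ln t - k^-1 -> has_der wkbG x (- p1 x * (g x * g1 x)).
  move=> x1; have q0 := wkbq_gt0 x1; rewrite /wkbG /wkbF; apply: der_eq.
    der_with ltac:(first [exact: dg|exact: dg1|exact: dp|exact: der_wkbq
      |apply: derV; first by rewrite gt_eqF]).
  rewrite /= /p1 /wkbp.
  have Q2 : t ^+ 2 = wkbq x ^+ 2 + expR x ^+ 2.
    rewrite /wkbq sqr_sqrtr ?subrK //; move: q0; rewrite /wkbq sqrtr_gt0.
    exact: ltW.
  by rewrite Q2; field; rewrite gt_eqF.
have dH x : x <= ln t - k^-1 -> has_der (fun x => wkbG x * expR (wkbp x)) x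
    (expR (wkbp x) * (p1 x * (wkbG x - g x * g1 x))).
  move=> x1; apply: der_eq.
    by der_with ltac:(first [exact: dG|exact: dp]).
  by rewrite /=; ring.
apply: (der_ndecr s1 (fun x hx => dH x _)) => x /andP[x0 x1] //.
(* Nonnegativity rests on p' >= 0 and on G - g g' >= F - 2|g g'| >= 0, the latter by p <= 1 and
   [wkbF_ge]. *)
rewrite mulr_ge0 ?expR_ge0 // mulr_ge0 //.
  have q0 := wkbq_gt0 x1.
  by rewrite /p1 addr_ge0 // divr_ge0 ?exprn_ge0 ?(ltW q0) // mulr_ge0 // exprn_ge0 // expR_ge0.
have := wkbF_ge x1; have /andP[p0 p2] := wkbp_ge0_le1 x1; rewrite /wkbG.
have := ler_norm (g x * g1 x); have := normr_ge0 (g x * g1 x).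
move: (wkbF x) (wkbp x) p0 p2 => F p p0 p2 h1 h2 h3.
have : p * (g x * g1 x) <= 1 * `|g x * g1 x|.
  apply: (le_trans (ler_norm _)); rewrite normrM ger0_norm //.
  by apply: ler_wpM2r.
by lra.
Qed.

(* The constant is passed as a variable so that it is never computed with. *)
Lemma g_oscillating D s : D = 3600 -> s <= ln t - k^-1 ->
  wkbq s * g s ^+ 2 <= D * k * a ^+ 2.
Proof.
kfacts.
move=> -> s1; have q0 := wkbq_gt0 s1.
have GF x : x <= ln t - k^-1 -> wkbF x / 2 <= wkbG x <= 3 / 2 * wkbF x.
  move=> x1; have := wkbF_ge x1; have /andP[p0 p2] := wkbp_ge0_le1 x1; rewrite /wkbG.
  move: (wkbF x) (wkbp x) p0 p2 => F p p0 p2 h1.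
  have : `|p * (g x * g1 x)| <= 1 * `|g x * g1 x|.
    by rewrite normrM (ger0_norm p0); apply: ler_wpM2r.
  rewrite ler_norml => /andP[h2 h3].
  by apply/andP; split; lra.
have F0 x : x <= ln t - k^-1 -> 0 <= wkbF x.
  by move=> /wkbF_ge; apply: le_trans; rewrite mulr_ge0.
have s2 : ln t - k^-1 <= ln t - k^-1 by [].
(* 12 = 2 * (3/2) * 4: the two sides of [GF], and exp(p) <= e <= 4 at the right end. *)
have hF : wkbF s <= 12 * wkbF (ln t - k^-1).
  have /andP[h1 _] := GF _ s1; have /andP[h3 h2] := GF _ s2.
  have /andP[p0 _] := wkbp_ge0_le1 s1; have /andP[_ p1] := wkbp_ge0_le1 s2.
  have h4 := wkbG_monotone s1; have f1 := F0 _ s1; have f2 := F0 _ s2.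
  have h5 : wkbG s <= wkbG s * expR (wkbp s).
    by apply: ler_peMr; [lra|rewrite -[leLHS]expR0 ler_expR].
  have h6 : wkbG (ln t - k^-1) * expR (wkbp (ln t - k^-1)) <=
      3 / 2 * wkbF (ln t - k^-1) * 4.
    by apply: ler_pM; rewrite ?expR_ge0 ?expR_le4 //; lra.
  by lra.
have hN : wkbF (ln t - k^-1) <= 296 * k * a ^+ 2.
  have hs : ln t - k^-1 <= ln t - k^-1 <= ln t by apply/andP; split; lra.
  have := energy_left hs; rewrite /energy /wkbF => hE.
  have q1 := wkbq_ge s2; have q2 : wkbq (ln t - k^-1) <= 2 * k.
    rewrite -[leRHS]ger0_norm ?mulr_ge0 ?(ltW k0) // -sqrtr_sqr /wkbq ler_wsqrtr //.
    rewrite expR_sqr_lnD -k3; have := expR_ge1Dx (2 * - k^-1).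
    move=> h; have -> : k ^+ 3 - k ^+ 3 * expR (2 * - k^-1) = k ^+ 3 * (1 - expR (2 * - k^-1)) by ring.
    apply: (@le_trans _ _ (k ^+ 3 * (2 * k^-1))).
      by rewrite ler_pM2l ?exprn_gt0 //; lra.
    have -> : k ^+ 3 * (2 * k^-1) = 2 * k ^+ 2 by field; rewrite gt_eqF.
    by have := sqr_ge0 k; rewrite exprMn; lra.
  set x := ln t - k^-1 in hE q1 q2 *.
  have e1 : wkbq x * g x ^+ 2 <= 2 * k * g x ^+ 2 by rewrite ler_wpM2r ?sqr_ge0.
  have e2 : g1 x ^+ 2 / wkbq x <= g1 x ^+ 2 / k.
    by rewrite ler_wpM2l ?sqr_ge0 // lef_pV2 ?posrE // wkbq_gt0.
  have e3 : 2 * k * g x ^+ 2 + g1 x ^+ 2 / k <=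
      2 / k * (g1 x ^+ 2 + k ^+ 2 * g x ^+ 2).
    have -> : 2 / k * (g1 x ^+ 2 + k ^+ 2 * g x ^+ 2) = 2 * k * g x ^+ 2 + g1 x ^+ 2 / k + g1 x ^+ 2 / k.
      by field; rewrite gt_eqF.
    by rewrite lerDl divr_ge0 ?sqr_ge0 // ltW.
  have e4 : 2 / k * (g1 x ^+ 2 + k ^+ 2 * g x ^+ 2) <= 2 / k * (148 * k ^+ 2 * a ^+ 2).
    by rewrite ler_wpM2l // divr_ge0 // ltW.
  have -> : 296 * k * a ^+ 2 = 2 / k * (148 * k ^+ 2 * a ^+ 2) by field; rewrite gt_eqF.
  by lra.
(* It remains that 12 * 296 = 3552 <= 3600. *)
have : wkbq s * g s ^+ 2 <= wkbF s.
  by rewrite /wkbF lerDl divr_ge0 ?sqr_ge0 // ltW.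
have : 0 <= k * a ^+ 2 by rewrite mulr_ge0 ?sqr_ge0 // ltW.
by lra.
Qed.

End turning_point.

End bessel_ode.

(** * Uniqueness of sine series *)

Section sine_series.
Variable R : realType.

(** Multiplying by 2 sin(pi d / P), which is positive as 0 < d < P, makes the sum telescope over a
    full period. *)
Lemma sum_cos_roots (d P : nat) : (0 < d < P)%N ->
  \sum_(j < P) cos (2 * pi * d%:R * j%:R / P%:R) = 0 :> R.
Proof.
move=> /andP[d0 dP]; have P0 : (0 < P)%N by apply: leq_trans dP.
have P0R : 0 < P%:R :> R by rewrite ltr0n.
pose th : R := pi * d%:R / P%:R.
have th0 : 0 < sin th.
  apply: sin_gt0_pi; rewrite /th; apply/andP; split.
    by rewrite divr_gt0 // mulr_gt0 ?pi_gt0 ?ltr0n.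
  by rewrite ltr_pdivrMr // ltr_pM2l ?pi_gt0 // ltr_nat.
have h n : 2 * sin th * \sum_(j < n) cos (2 * pi * d%:R * j%:R / P%:R) =
   sin (2 * n%:R * th - th) + sin th.
  elim: n => [|n IHn].
    by rewrite big_ord0 mulr0 mulr0 mul0r sub0r sinN addNr.
  rewrite big_ord_recr /= mulrDr IHn.
  have -> : 2 * pi * d%:R * n%:R / P%:R = 2 * n%:R * th.
    by rewrite /th; field; rewrite gt_eqF.
  have -> : 2 * n.+1%:R * th - th = 2 * n%:R * th + th.
    by rewrite -natr1; ring.
  by rewrite sinB sinD; ring.
have e : 2 * P%:R * th - th = - th + (pi *+ 2) *+ d.
  by rewrite /th -mulr_natr -[pi *+ 2]mulr_natr; field; rewrite gt_eqF.
have := h P; rewrite e (periodicn (@sinD2pi R)) sinN addNr => /eqP.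
by rewrite mulf_eq0 mulf_eq0 (gt_eqF th0) pnatr_eq0 /= => /eqP.
Qed.

(** Discrete orthogonality on P equidistant points; m + n < P excludes aliasing. *)
Lemma sum_sin_sin (m n P : nat) : (0 < m)%N -> (0 < n)%N -> (m + n < P)%N ->
  \sum_(j < P) sin (2 * pi * m%:R * (j%:R / P%:R)) * sin (2 * pi * n%:R * (j%:R / P%:R))
  = (if m == n then P%:R / 2 else 0) :> R.
Proof.
move=> m0 n0 mnP.
wlog nm : m n m0 n0 mnP / (n <= m)%N.
  move=> wl; have [h|h] := leqP n m; first exact: wl.
  rewrite eq_sym -(wl n m) // ?(addnC n) // 1?ltnW //.
  by apply: eq_bigr => j _; rewrite mulrC.
have e (j : 'I_P) : sin (2 * pi * m%:R * (j%:R / P%:R)) * sin (2 * pi * n%:R * (j%:R / P%:R)) =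
    2^-1 * cos (2 * pi * (m - n)%:R * j%:R / P%:R)
    - 2^-1 * cos (2 * pi * (m + n)%:R * j%:R / P%:R) :> R.
  rewrite natrB // natrD.
  have -> : 2 * pi * (m%:R - n%:R) * j%:R / P%:R =
     2 * pi * m%:R * (j%:R / P%:R) - 2 * pi * n%:R * (j%:R / P%:R) :> R by ring.
  have -> : 2 * pi * (m%:R + n%:R) * j%:R / P%:R =
     2 * pi * m%:R * (j%:R / P%:R) + 2 * pi * n%:R * (j%:R / P%:R) :> R by ring.
  by rewrite cosB cosD; field.
rewrite (eq_bigr _ (fun j _ => e j)) sumrB -!mulr_sumr (@sum_cos_roots (m + n)); last by lia.
case: eqP => [->|/eqP mn].
  rewrite subnn (eq_bigr (fun=> 1)); last by move=> j _; rewrite mulr0 !mul0r cos0.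
  by rewrite sumr_const card_ord mulr0 subr0 mulrC.
by rewrite sum_cos_roots; [rewrite mulr0 subr0|lia].
Qed.

(** The series is paired with sin(2 pi m x) over finitely many sample points, so pointwise
    convergence suffices and no limit is exchanged with an integral. Low frequencies are separated
    by orthogonality, high ones are small by absolute convergence. *)
Lemma sine_series_eq0 (c : nat -> R) (M : R) :
  (forall N, \sum_(1 <= n < N.+1) `|c n| <= M) ->
  (forall x, \sum_(1 <= n < N.+1) c n * sin (2 * pi * n%:R * x) @[N --> \oo] --> (0 : R)) ->
  forall m, (0 < m)%N -> c m = 0.
Proof.
move=> cM cs m m0.
apply/eqP; rewrite -normr_le0; apply/ler_addgt0Pl => e e0; rewrite addr0.
pose S N := \sum_(1 <= n < N.+1) `|c n|.
have Sincr N1 N2 : (N1 <= N2)%N -> S N2 - S N1 = \sum_(N1.+1 <= n < N2.+1) `|c n|.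
  move=> h; rewrite /S [X in X - _](@big_cat_nat _ _ _ N1.+1) //=.
  by rewrite addrAC subrr add0r.
have Scvg : cvgn S.
  apply: nondecreasing_is_cvgn; last by exists M => _ [n _ <-]; exact: cM.
  by move=> N1 N2 h; rewrite -subr_ge0 Sincr // sumr_ge0.
have [N0 [mN0 N0P]] : exists N0, (m <= N0)%N /\ forall N, (N0 <= N)%N -> S N - S N0 <= e / 4.
  have e8 : 0 < e / 8 by rewrite divr_gt0.
  have /cvgrPdist_le /(_ _ e8) [N1 _ hN1] := Scvg.
  exists (maxn m N1); split; first exact: leq_maxl.
  move=> N hN.
  have /= := hN1 N (leq_trans (leq_maxr _ _) hN).
  have /= := hN1 (maxn m N1) (leq_maxr _ _).
  by rewrite !ler_norml => /andP[? ?] /andP[? ?]; lra.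
(* All m, n <= N0 satisfy m + n < P. *)
pose P := (N0.*2).+1.
have P0 : 0 < P%:R :> R by rewrite ltr0n.
pose W n := \sum_(j < P) sin (2 * pi * m%:R * (j%:R / P%:R)) * sin (2 * pi * n%:R * (j%:R / P%:R)) : R.
pose T N := \sum_(1 <= n < N.+1) c n * W n.
have TE : T = (fun N => \sum_(j < P) sin (2 * pi * m%:R * (j%:R / P%:R)) *
     \sum_(1 <= n < N.+1) c n * sin (2 * pi * n%:R * (j%:R / P%:R))).
  apply/funext => N; rewrite /T /W.
  under eq_bigr do rewrite mulr_sumr.
  rewrite exchange_big /=; apply: eq_bigr => j _; rewrite mulr_sumr.
  by apply: eq_bigr => n _; ring.
have Tcvg : T N @[N --> \oo] --> (0 : R).
  rewrite TE.
  have cvgS (n : nat) (f : 'I_n -> nat -> R) : (forall j, f j N @[N --> \oo] --> (0 : R)) ->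
      \sum_(j < n) f j N @[N --> \oo] --> (0 : R).
    elim: n f => [|n IHn] f fj.
      by under eq_fun do rewrite big_ord0; exact: cvg_cst.
    under eq_fun do rewrite big_ord_recr /=.
    have := cvgD (IHn _ (fun j => fj (widen_ord (leqnSn n) j))) (fj ord_max).
    by rewrite addr0; apply.
  apply: (cvgS P) => j.
  have := cvgMr (a := sin (2 * pi * m%:R * (j%:R / P%:R))) (cs (j%:R / P%:R)).
  by rewrite mulr0; apply.
have Wb n : `|W n| <= P%:R.
  apply: (le_trans (ler_norm_sum _ _ _)).
  apply: (@le_trans _ _ (\sum_(j < P) 1)); last by rewrite sumr_const card_ord.
  apply: ler_sum => j _; rewrite normrM -[leRHS]mulr1; apply: ler_pM => //.
    by rewrite ler_norml sin_geN1 sin_le1.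
  by rewrite ler_norml sin_geN1 sin_le1.
have TN N : (N0 <= N)%N -> `|T N - c m * (P%:R / 2)| <= P%:R * (e / 4).
  move=> hN; rewrite /T (@big_cat_nat _ _ _ N0.+1) //=.
  have -> : \sum_(1 <= n < N0.+1) c n * W n = c m * (P%:R / 2).
    rewrite (eq_big_nat _ _ (F2 := fun n => if m == n then c m * (P%:R / 2) else 0)).
      rewrite -big_mkcond /= (big_rem m) /= ?mem_index_iota; last by lia.
      rewrite eqxx big_seq_cond big_pred0 ?addr0 // => i.
      apply/andP => -[h /eqP hi]; move: h; rewrite -hi mem_rem_uniqF //.
      exact: iota_uniq.
    move=> n /andP[n1 n2]; rewrite /W sum_sin_sin //; last by rewrite /P; lia.
    by case: eqP => [->|_] //; rewrite mulr0.
  rewrite addrAC subrr add0r; apply: (le_trans (ler_norm_sum _ _ _)).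
  apply: (@le_trans _ _ (\sum_(N0.+1 <= n < N.+1) `|c n| * P%:R)).
    by apply: ler_sum => n _; rewrite normrM ler_wpM2l.
  by rewrite -mulr_suml -Sincr // mulrC ler_pM2l // N0P.
have : `|c m * (P%:R / 2)| <= P%:R * (e / 4) + P%:R * (e / 4).
  have Pe : 0 < P%:R * (e / 4) by rewrite mulr_gt0 // divr_gt0.
  have /cvgrPdist_le /(_ _ Pe) [N1 _ hN1] := Tcvg.
  have /= := hN1 (maxn N0 N1) (leq_maxr _ _); rewrite sub0r normrN => h1.
  have h2 := TN (maxn N0 N1) (leq_maxl _ _).
  have := ler_normB (T (maxn N0 N1)) (T (maxn N0 N1) - c m * (P%:R / 2)).
  by rewrite opprB addrC subrK; lra.
rewrite normrM (@gtr0_norm _ (P%:R / 2)) ?divr_gt0 // => h.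
rewrite -(ler_pM2r (x := P%:R / 2)) ?divr_gt0 //; lra.
Qed.

End sine_series.

(** * Fourier coefficients of Hecke-Maass forms *)

Section complex_modulus.
Variable R : realType.

Lemma cmodE (w : R[i]) :
  cmod w = Num.sqrt (complex.Re w ^+ 2 + complex.Im w ^+ 2).
Proof. by rewrite /cmod normc_def. Qed.

Lemma normr_Re_le_cmod (w : R[i]) : `|complex.Re w| <= cmod w.
Proof. by rewrite cmodE -sqrtr_sqr ler_wsqrtr // lerDl sqr_ge0. Qed.

Lemma normr_Im_le_cmod (w : R[i]) : `|complex.Im w| <= cmod w.
Proof. by rewrite cmodE -sqrtr_sqr ler_wsqrtr // lerDr sqr_ge0. Qed.

Lemma cmod_ge0 (w : R[i]) : 0 <= cmod w.
Proof. by rewrite cmodE sqrtr_ge0. Qed.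

Lemma eq_cvgn (f g : nat -> R) (l l' : R) : f N @[N --> \oo] --> l ->
  (forall N, f N = g N) -> l = l' -> g N @[N --> \oo] --> l'.
Proof. by move=> h fg <-; rewrite (_ : g = f) //; apply/funext => N. Qed.

Lemma summable_partial_le (D : set int) (f : int -> R) (h : nat -> int) :
  (forall n, 0 <= f n) -> injective h -> (forall n, (0 < n)%N -> D (h n)) ->
  summable D (fun n => (f n)%:E) ->
  exists M, forall N, \sum_(1 <= n < N.+1) f (h n) <= M.
Proof.
move=> f0 hinj hD sf.
have e0 : (0 <= \esum_(x in D) `|(f x)%:E|)%E by apply: esum_ge0 => i _; exact: abse_ge0.
have fE : (\esum_(x in D) `|(f x)%:E|)%E \is a fin_num by rewrite -summableE.
exists (fine (\esum_(x in D) `|(f x)%:E|)%E) => N.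
rewrite -lee_fin fineK //; apply: esum_ge.
exists [set` [seq h n | n <- index_iota 1 N.+1]].
  split; first exact: finite_seq.
  move=> x /= /mapP[n]; rewrite mem_index_iota => /andP[n1 _] ->; exact: hD.
rewrite -fsbig_seq /=; last by rewrite map_inj_uniq // iota_uniq.
rewrite big_map -sumEFin; apply: lee_sum => n _.
by rewrite lee_fin ler_norm.
Qed.

End complex_modulus.

Lemma det_mx22 (A : 'M[int]_2) : \det A = A 0 0 * A 1 1 - A 0 1 * A 1 0.
Proof.
rewrite (expand_det_row _ 0) !big_ord_recl big_ord0 /cofactor !det_mx11 !mxE /=.
have e0 : lift 0 0 = 1 :> 'I_2 by exact: val_inj.
have e1 : lift 1 0 = 0 :> 'I_2 by exact: val_inj.
by rewrite addr0 !e0 e1 /= expr0 mul1r expr1 mulN1r mulrN.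
Qed.

Section maass.
Local Open Scope complex_scope.
Local Open Scope ring_scope.
Variables (R : realType) (phi : R * R -> R) (t : R).
Variables (rho : int -> R[i]) (lambda : int -> R).
Hypothesis form : even_hecke_maass_cusp_form phi t rho lambda.

Local Notation K := (besselK_it t).
Local Notation r1 := (complex.Re (rho 1)).
Local Notation r2 := (complex.Im (rho 1)).
Local Notation A n := (lambda n%:Z + lambda (- n%:Z)).
Local Notation B n := (lambda n%:Z - lambda (- n%:Z)).

Lemma maass_neq0 : exists2 z, upper_half_plane z & phi z != 0.
Proof.
have h := hm_normalized form; apply/not_exists2P => hz.
have : (0 = 1 :> \bar R)%E.
  rewrite -h; apply/esym; apply: integral0_eq => z [z0 _ _].
  have [//|/negP] := hz z; rewrite negbK => /eqP ->.
  by rewrite expr0n mul0r.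
by move/eqP; rewrite eq_sym onee_eq0.
Qed.

Lemma fourier_pair (z : R * R) n : (0 < n)%N ->
  fourier_term t rho z n%:Z + fourier_term t rho z (- n%:Z) =
  (r1 * (Num.sqrt z.2 * (A n * K (2 * pi * n%:R * z.2) * cos (2 * pi * n%:R * z.1)))
   - r2 * (Num.sqrt z.2 * (B n * K (2 * pi * n%:R * z.2) * sin (2 * pi * n%:R * z.1)))) +i*
  (r2 * (Num.sqrt z.2 * (A n * K (2 * pi * n%:R * z.2) * cos (2 * pi * n%:R * z.1)))
   + r1 * (Num.sqrt z.2 * (B n * K (2 * pi * n%:R * z.2) * sin (2 * pi * n%:R * z.1)))).
Proof.
move=> n0; rewrite /fourier_term (hm_rho form (n := n%:Z)); last by lia.
rewrite (hm_rho form (n := - n%:Z)); last by lia.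
rewrite mulrNz normrN -pmulrn (ger0_norm (ler0n _ _)).
rewrite mulrN !mulNr cosN sinN.
case: (rho 1) => x1 x2; simpc => /=.
by congr (_ +i* _); ring.
Qed.

Lemma cmod_fourier_term (z : R * R) (n : int) : n != 0 ->
  `|r1| * (Num.sqrt z.2 * (`|lambda n| * `|K (2 * pi * `|n%:~R| * z.2)|)) <=
  cmod (fourier_term t rho z n).
Proof.
move=> n0; rewrite cmodE /fourier_term (hm_rho form n0).
set k := K _; set x := _ * z.1.
have -> : `|r1| * (Num.sqrt z.2 * (`|lambda n| * `|k|)) =
  Num.sqrt ((r1 * (Num.sqrt z.2 * (lambda n * k))) ^+ 2).
  by rewrite sqrtr_sqr !normrM (ger0_norm (sqrtr_ge0 _)).
apply: ler_wsqrtr; case: (rho 1) => x1 x2; simpc => /=.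
have e := cos2Dsin2 x.
set q := Num.sqrt z.2.
have -> : (lambda n * x1 * (q * k) * cos x - lambda n * x2 * (q * k) * sin x) ^+ 2 +
  (lambda n * x1 * (q * k) * sin x + lambda n * x2 * (q * k) * cos x) ^+ 2 =
  (x1 * (q * (lambda n * k))) ^+ 2 * (cos x ^+ 2 + sin x ^+ 2) +
  (x2 * (q * (lambda n * k))) ^+ 2 * (cos x ^+ 2 + sin x ^+ 2) by ring.
by rewrite e !mulr1 lerDl sqr_ge0.
Qed.

Definition cos_sum z N : R :=
  \sum_(1 <= n < N.+1) A n * K (2 * pi * n%:R * z.2) * cos (2 * pi * n%:R * z.1).

Definition sin_sum z N : R :=
  \sum_(1 <= n < N.+1) B n * K (2 * pi * n%:R * z.2) * sin (2 * pi * n%:R * z.1).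

Lemma fourier_ReIm z : upper_half_plane z ->
  r1 * (Num.sqrt z.2 * cos_sum z N) - r2 * (Num.sqrt z.2 * sin_sum z N)
    @[N --> \oo] --> phi z /\
  r2 * (Num.sqrt z.2 * cos_sum z N) + r1 * (Num.sqrt z.2 * sin_sum z N)
    @[N --> \oo] --> (0 : R).
Proof.
move=> z0; have [_ h] := hm_fourier form z0.
set S := fun N : nat => _ in h.
have SE N : \sum_(1 <= n < N.+1)
     (fourier_term t rho z n%:Z + fourier_term t rho z (- n%:Z)) - (phi z)%:C =
  (r1 * (Num.sqrt z.2 * cos_sum z N) - r2 * (Num.sqrt z.2 * sin_sum z N) - phi z) +i*
  (r2 * (Num.sqrt z.2 * cos_sum z N) + r1 * (Num.sqrt z.2 * sin_sum z N)).
  have -> : \sum_(1 <= n < N.+1)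
     (fourier_term t rho z n%:Z + fourier_term t rho z (- n%:Z)) =
   (r1 * (Num.sqrt z.2 * cos_sum z N) - r2 * (Num.sqrt z.2 * sin_sum z N)) +i*
   (r2 * (Num.sqrt z.2 * cos_sum z N) + r1 * (Num.sqrt z.2 * sin_sum z N)).
    elim: N => [|N IHN].
      by rewrite /cos_sum /sin_sum !big_nil !mulr0 subr0 addr0.
    have -> : cos_sum z N.+1 = cos_sum z N +
        A N.+1 * K (2 * pi * N.+1%:R * z.2) * cos (2 * pi * N.+1%:R * z.1).
      by rewrite /cos_sum big_nat_recr.
    have -> : sin_sum z N.+1 = sin_sum z N +
        B N.+1 * K (2 * pi * N.+1%:R * z.2) * sin (2 * pi * N.+1%:R * z.1).
      by rewrite /sin_sum big_nat_recr.
    rewrite big_nat_recr //= IHN fourier_pair //; simpc => /=.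
    by congr (_ +i* _); ring.
  by simpc.
have squeeze (f : nat -> R) : (forall N, `|f N| <= S N) -> f N @[N --> \oo] --> (0 : R).
  move=> fS; apply: norm_cvg0; apply: (squeeze_cvgr _ (cvg_cst 0) h).
  by near=> N; rewrite normr_ge0 fS.
split.
  apply/subr_cvg0; apply: squeeze => N; rewrite /S SE.
  exact: (normr_Re_le_cmod (_ +i* _)).
apply: squeeze => N; rewrite /S SE.
exact: (normr_Im_le_cmod (_ +i* _)).
Unshelve. all: by end_near. Qed.

(** The expansions at z and at its reflection differ by the sign of the sine part: half the sum of
    the real parts and half the difference of the imaginary parts isolate the two series. *)
Lemma cos_sin_cvg z : upper_half_plane z ->
  r1 * (Num.sqrt z.2 * cos_sum z N) @[N --> \oo] --> phi z /\
  r1 * (Num.sqrt z.2 * sin_sum z N) @[N --> \oo] --> (0 : R).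
Proof.
move=> z0; have [h1 h2] := fourier_ReIm z0.
have z0' : upper_half_plane (- z.1, z.2) by [].
have [h3 h4] := fourier_ReIm z0'.
have cE : cos_sum (- z.1, z.2) = cos_sum z.
  by apply/funext => N; apply: eq_bigr => n _ /=; rewrite mulrN cosN.
have sE : sin_sum (- z.1, z.2) = (fun N => - sin_sum z N).
  apply/funext => N; rewrite /sin_sum -sumrN.
  by apply: eq_bigr => n _ /=; rewrite mulrN sinN mulrN.
rewrite cE sE /= in h3 h4.
rewrite (hm_even form) // in h3.
split.
- by apply: (eq_cvgn (cvgMr (a := 2^-1) (cvgD h1 h3))) => [N|]; rewrite ?fctE; field.
- by apply: (eq_cvgn (cvgMr (a := 2^-1) (cvgB h2 h4))) => [N|]; rewrite ?fctE; field.
Qed.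

Lemma r1_neq0 : r1 != 0.
Proof.
have [z z0 /negP pz] := maass_neq0; apply/negP => /eqP e; apply: pz.
have [h _] := cos_sin_cvg z0; apply/eqP.
move: h; under eq_fun do rewrite e mul0r.
by move/(cvg_lim (@Rhausdorff R)) <-; rewrite lim_cst.
Qed.

Lemma cvg_factor (a b : R) (f : nat -> R) : a != 0 -> b != 0 ->
  a * (b * f N) @[N --> \oo] --> (0 : R) -> f N @[N --> \oo] --> (0 : R).
Proof.
move=> a0 b0 h; apply: (eq_cvgn (cvgMr (a := (a * b)^-1) h)) => [N|].
  by field; rewrite a0 b0.
by rewrite mulr0.
Qed.

Lemma sin_sum_cvg0 z : upper_half_plane z -> sin_sum z N @[N --> \oo] --> (0 : R).
Proof.
move=> z0; have [_] := cos_sin_cvg z0; apply: cvg_factor; first exact: r1_neq0.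
by rewrite gt_eqF // sqrtr_gt0.
Qed.

Lemma cos_sum_cvg0 z : upper_half_plane z -> phi z = 0 ->
  cos_sum z N @[N --> \oo] --> (0 : R).
Proof.
move=> z0 pz; have [h _] := cos_sin_cvg z0; rewrite pz in h.
apply: cvg_factor h; first exact: r1_neq0.
by rewrite gt_eqF // sqrtr_gt0.
Qed.

Lemma coeff_sum_bounded y : 0 < y -> exists M, forall N,
  \sum_(1 <= n < N.+1) (`|lambda n%:Z| + `|lambda (- n%:Z)|) * `|K (2 * pi * n%:R * y)| <= M.
Proof.
move=> y0; have z0 : upper_half_plane (0 : R, y) by [].
have [h _] := hm_fourier form z0.
have r0 : 0 < `|r1| by rewrite normr_gt0 r1_neq0.
have q0 : 0 < Num.sqrt y by rewrite sqrtr_gt0.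
have [M1 h1] : exists M, forall N, \sum_(1 <= n < N.+1)
    cmod (fourier_term t rho (0, y) n%:Z) <= M.
  by apply: summable_partial_le h => [n|m n []|n n0] //=; [exact: cmod_ge0|lia].
have [M2 h2] : exists M, forall N, \sum_(1 <= n < N.+1)
    cmod (fourier_term t rho (0, y) (- n%:Z)) <= M.
  apply: (summable_partial_le (h := fun n : nat => - n%:Z)) h => [n|m n|n n0] /=.
  - exact: cmod_ge0.
  - by lia.
  - by lia.
exists ((`|r1| * Num.sqrt y)^-1 * (M1 + M2)) => N.
rewrite ler_pdivlMl ?mulr_gt0 // mulr_sumr.
apply: le_trans (lerD (h1 N) (h2 N)); rewrite -big_split /=.
rewrite big_nat_cond [leRHS]big_nat_cond; apply: ler_sum => n /andP[/andP[n1 _] _].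
have np : n%:Z != 0 by lia. have nm : - n%:Z != 0 by lia.
have := lerD (cmod_fourier_term (0, y) np) (cmod_fourier_term (0, y) nm).
rewrite mulrNz normrN -pmulrn (ger0_norm (ler0n _ _)) /=.
by apply: le_trans; rewrite le_eqVlt; apply/orP; left; apply/eqP; ring.
Qed.

Lemma K_besselg u : 0 < u -> K u = besselg t (ln u).
Proof. by move=> u0; rewrite /besselg lnK. Qed.

Let t0 : 0 < t := hm_spectral_gt0 form.

Lemma besselg_neq0 : exists s, besselg t s != 0.
Proof.
apply/not_existsP => h; have [z z0 /negP pz] := maass_neq0; apply: pz.
have [c _] := cos_sin_cvg z0; apply/eqP.
move: c; rewrite (_ : (fun N => _) = (fun=> 0)).
  by move/(cvg_lim (@Rhausdorff R)) <-; rewrite lim_cst.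
apply/funext => N; rewrite /cos_sum big_nat_cond big1 ?mulr0 // => n /andP[/andP[n1 _] _].
rewrite K_besselg; last by rewrite !mulr_gt0 ?pi_gt0 ?ltr0n.
have /negP := h (ln (2 * pi * n%:R * z.2)); rewrite negbK => /eqP ->.
by rewrite mulr0 mul0r.
Qed.

(** At any fixed height the sine series vanishes for all x. The height is chosen so that the n-th
    Bessel factor is a nonzero value of K_it. *)
Lemma lambdaN n : (0 < n)%N -> lambda (- n%:Z) = lambda n%:Z.
Proof.
move=> n0; have [s sn0] := besselg_neq0.
have nR : 0 < n%:R :> R by rewrite ltr0n.
pose y : R := expR s / (2 * pi * n%:R).
have d0 : 0 < 2 * pi * n%:R :> R by rewrite !mulr_gt0 ?pi_gt0.
have y0 : 0 < y by rewrite divr_gt0 ?expR_gt0.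
have [M hM] := coeff_sum_bounded y0.
have := @sine_series_eq0 R (fun n => B n * K (2 * pi * n%:R * y)) M _ _ n n0.
have -> : 2 * pi * n%:R * y = expR s by rewrite /y mulrC divfK // gt_eqF.
move=> h; have {h} : B n * K (expR s) = 0.
  apply: h => [N|x].
    apply: le_trans (hM N); apply: ler_sum => m _; rewrite normrM ler_wpM2r //.
    exact: ler_normB.
  by have := @sin_sum_cvg0 (x, y) y0.
move/eqP; rewrite mulf_eq0 -/(besselg t s) (negbTE sn0) orbF subr_eq0.
by move/eqP.
Qed.

Lemma cusp_zero_series z : upper_half_plane z -> phi z = 0 ->
  \sum_(1 <= n < N.+1) lambda n%:Z * K (2 * pi * n%:R * z.2) * cos (2 * pi * n%:R * z.1)
    @[N --> \oo] --> (0 : R).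
Proof.
move=> z0 pz; apply: (eq_cvgn (cvgMr (a := 2^-1) (cos_sum_cvg0 z0 pz))); last first.
  by rewrite mulr0.
move=> N; rewrite /cos_sum mulr_sumr big_nat_cond [RHS]big_nat_cond; apply: eq_bigr => n /andP[/andP[n1 _] _].
by rewrite lambdaN //; field.
Qed.

(** Termwise comparison with height 1/2. For large n, [ode_decay] with rate 1 gains a factor 1/(2y),
    which absorbs sqrt(y) <= 2y; the finitely many other terms use |K(u)| <= 2/u. *)
Lemma cusp_bounded_high : exists M, forall z, 1 / 2 <= z.2 -> `|phi z| <= M.
Proof.
have h2 : 0 < 1 / 2 :> R by lra.
have [M1 hM1] := coeff_sum_bounded h2.
(* For n >= n0 the argument pi n at height 1/2 is at least t + 1, far enough beyond the turning
   point for rate 1. *)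
pose n0 := (Num.truncn (t + 1)).+1.
have hn0 n : (n0 <= n)%N -> t + 1 <= n%:R.
  move=> h; apply: ltW; apply: (@lt_le_trans _ _ n0%:R); last by rewrite ler_nat.
  by apply: truncnS_gt.
pose a (n : nat) : R := `|lambda n%:Z| + `|lambda (- n%:Z)|.
pose M2 : R := \sum_(1 <= n < n0) 2 * a n.
exists (`|r1| * (M1 + M2)) => z zy.
have y0 : 0 < z.2 by lra.
have z0 : upper_half_plane z by [].
have [c _] := cos_sin_cvg z0.
have q0 : 0 < Num.sqrt z.2 by rewrite sqrtr_gt0.
have qy : Num.sqrt z.2 <= 2 * z.2.
  rewrite -[leRHS]ger0_norm; last by lra.
  by rewrite -sqrtr_sqr ler_wsqrtr //; nra.
have a0 n : 0 <= a n by rewrite addr_ge0.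
have pi1 : 2 <= pi :> R by exact: pi_ge2.
have term n : (0 < n)%N -> Num.sqrt z.2 * (a n * `|K (2 * pi * n%:R * z.2)|) <=
    a n * `|K (2 * pi * n%:R * (1 / 2))| + (if (n < n0)%N then 2 * a n else 0).
  move=> n1; have nR : 1 <= n%:R :> R by rewrite ler1n.
  have d0 : 0 < 2 * pi * n%:R :> R by rewrite mulr_gt0 ?mulr_gt0 ?pi_gt0 ?ltr0n.
  have u0 := mulr_gt0 d0 y0; have v0 := mulr_gt0 d0 h2.
  rewrite !K_besselg // mulrCA; case: ltnP => hn.
    have := besselg_bound t (ln (2 * pi * n%:R * z.2)).
    rewrite expRN lnK ?posrE // => hb.
    rewrite -[leLHS]add0r [2 * a n]mulrC; apply: lerD; first by rewrite mulr_ge0.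
    apply: ler_wpM2l => //.
    apply: (@le_trans _ _ (2 * z.2 * (2 * (2 * pi * n%:R * z.2)^-1))).
      by apply: ler_pM => //; exact: ltW.
    rewrite mulrA ler_pdivrMr //.
    have : 0 < z.2 * n%:R by rewrite mulr_gt0 //; lra.
    by nra.
  rewrite addr0 ler_wpM2l //.
  have hd : t ^+ 2 + 1 ^+ 2 <= expR (ln (2 * pi * n%:R * (1 / 2))) ^+ 2.
    rewrite lnK ?posrE // (_ : 2 * pi * n%:R * (1 / 2) = pi * n%:R); last by field.
    have tp := t0; have h := hn0 _ hn.
    have : t + 1 <= pi * n%:R by nra.
    by nra.
  have hs : ln (2 * pi * n%:R * (1 / 2)) <= ln (2 * pi * n%:R * z.2).
    by rewrite ler_ln ?posrE // ler_pM2l.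
  have := ode_decay (der_besselg t) (der_besselg1 t) (besselg_bound t) ler01 hd hs.
  rewrite (mul1r (ln _ - _)) -ln_div ?posrE // expRN lnK ?posrE ?divr_gt0 //.
  have -> : (2 * pi * n%:R * z.2 / (2 * pi * n%:R * (1 / 2)))^-1 = (2 * z.2)^-1.
    by field; rewrite !gt_eqF //; lra.
  have aux (q x G y : R) : 0 < y -> 0 <= x -> q <= 2 * y -> x <= G * (2 * y)^-1 -> q * x <= G.
    move=> yp x0 qle; rewrite ler_pdivlMr; last by lra.
    by apply: le_trans; rewrite mulrC ler_wpM2l.
  exact: aux.
have bound N : `|r1 * (Num.sqrt z.2 * cos_sum z N)| <= `|r1| * (M1 + M2).
  rewrite normrM ler_wpM2l // normrM (ger0_norm (ltW q0)) /cos_sum.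
  apply: (@le_trans _ _ (\sum_(1 <= n < N.+1) Num.sqrt z.2 * (a n * `|K (2 * pi * n%:R * z.2)|))).
    rewrite -mulr_sumr ler_pM2l //; apply: (le_trans (ler_norm_sum _ _ _)).
    apply: ler_sum => n _; rewrite normrM -[leRHS]mulr1; apply: ler_pM => //; last first.
      by rewrite ler_norml cos_geN1 cos_le1.
    by rewrite normrM ler_wpM2r // ler_normD.
  apply: (@le_trans _ _ (\sum_(1 <= n < N.+1) (a n * `|K (2 * pi * n%:R * (1 / 2))|
      + (if (n < n0)%N then 2 * a n else 0)))).
    rewrite big_nat_cond [leRHS]big_nat_cond; apply: ler_sum => n /andP[/andP[n1 _] _].
    exact: term.
  rewrite big_split /=; apply: lerD; first exact: hM1.
  rewrite -big_mkcond /= /M2.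
  have [Nn|nN] := leqP N.+1 n0.
    rewrite (@big_cat_nat _ _ _ N.+1 1 n0) //=.
    apply: (@le_trans _ _ (\sum_(1 <= i < N.+1) 2 * a i)); last first.
      by rewrite lerDl sumr_ge0 // => i _; rewrite mulr_ge0.
    by rewrite big_mkcond /=; apply: ler_sum => i _; case: ifP => _; rewrite ?mulr_ge0.
  by rewrite [leRHS](@big_nat_widen _ _ _ 1 n0 N.+1) // ltnW.
rewrite -(cvg_lim (@Rhausdorff R) (cvg_norm c)).
apply: limr_le; last by apply: nearW.
by apply/cvg_ex; eexists; exact: (cvg_norm c).
Qed.

Lemma phi_translate (k : int) z : upper_half_plane z -> phi (z.1 + k%:~R, z.2) = phi z.
Proof.
move=> z0; pose g : 'M[int]_2 := \matrix_(i, j) (if i == 0 then (if j == 0 then 1 else k)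
  else (if j == 0 then 0 else 1)).
have dg : \det g = 1 by rewrite det_mx22 !mxE /= mulr0 subr0 mulr1.
rewrite -(hm_invariant form dg z0); congr phi.
rewrite /moebius /to_complex /of_complex !mxE /= !mul1r mul0r add0r invr1 mulr1.
by rewrite -(rmorph_int (real_complex R)) /=; simpc.
Qed.

Lemma phi_invert z : upper_half_plane z ->
  phi (- z.1 / (z.1 ^+ 2 + z.2 ^+ 2), z.2 / (z.1 ^+ 2 + z.2 ^+ 2)) = phi z.
Proof.
move=> z0; pose g : 'M[int]_2 := \matrix_(i, j) (if i == 0 then (if j == 0 then 0 else - 1)
  else (if j == 0 then 1 else 0)).
have dg : \det g = 1 by rewrite det_mx22 !mxE /= mulr1 mul0r sub0r opprK.
rewrite -(hm_invariant form dg z0); congr phi.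
rewrite /moebius /to_complex /of_complex !mxE /=.
rewrite !(mul0r, mul1r, addr0, subr0, oppr0, add0r).
by congr (_, _); ring.
Qed.

(** If |x| <= 1/2 and y < 1/2 then |z|^2 <= 1/2, so z -> -1/z at least doubles the height. Hence k
    steps of translation and inversion reach height 1/2. *)
Lemma cusp_bounded : exists M, forall z, upper_half_plane z -> `|phi z| <= M.
Proof.
have [M hM] := cusp_bounded_high; exists M.
suff h k z : upper_half_plane z -> 1 / 2 <= 2 ^+ k * z.2 -> `|phi z| <= M.
  move=> z z0; pose k := (Num.truncn (z.2^-1)).+1; apply: (h k) => //.
  have k1 : z.2^-1 <= k%:R by apply: ltW; exact: truncnS_gt.
  have k2 : k%:R <= 2 ^+ k :> R by rewrite -(natrX _ 2 k) ler_nat; exact/ltnW/ltn_expl.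
  have : 1 <= 2 ^+ k * z.2 by rewrite -ler_pdivrMr // div1r (le_trans k1).
  by lra.
elim: k z => [|k IHk] z z0 hz; first by apply: hM; move: hz; rewrite expr0 (mul1r z.2).
have [x1 x2] : exists2 x : R, `|x| <= 1 / 2 & phi z = phi (x, z.2).
  pose m := Num.floor (z.1 + 1 / 2); exists (z.1 + (- m)%:~R); last first.
    by rewrite phi_translate.
  have := floor_itv (z.1 + 1 / 2); rewrite -/m intrD => /andP[h1 h2].
  by rewrite mulrNz ler_norml; apply/andP; split; lra.
move=> ->; have [hy|hy] := leP (1 / 2) z.2; first exact: hM.
have zp : 0 < z.2 by [].
have w0 : upper_half_plane (x1, z.2) by [].
rewrite -(phi_invert w0) /=.
have d1 : x1 ^+ 2 <= 1 / 4.
  by rewrite -real_normK ?num_real //; have := normr_ge0 x1; nra.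
have d0 : 0 < x1 ^+ 2 + z.2 ^+ 2 by have := sqr_ge0 x1; nra.
have d2 : x1 ^+ 2 + z.2 ^+ 2 <= 1 / 2 by nra.
apply: IHk; rewrite /upper_half_plane /= ?divr_gt0 //.
have : 2 * z.2 <= z.2 / (x1 ^+ 2 + z.2 ^+ 2).
  by rewrite ler_pdivlMr //; nra.
have k0 : 0 < 2 ^+ k :> R by rewrite exprn_gt0.
move=> h; apply: (le_trans hz); rewrite exprS -mulrA mulrCA.
by rewrite ler_pM2l.
Qed.

(** The Hecke relation is tested against sup |phi|, which is finite and positive: at most n
    divisors, each contributing at most n values. *)
Lemma lambda_bound n : (0 < n)%N -> `|lambda n%:Z| <= n%:R ^+ 2.
Proof.
move=> n0; have [M hM] := cusp_bounded; have [zz zz0 pzz] := maass_neq0.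
pose E := [set `|phi z| | z in @upper_half_plane R].
have Esup : has_sup E.
  split; first by exists `|phi zz|, zz.
  by exists M => _ [z z0 <-]; exact: hM.
have Eub z : upper_half_plane z -> `|phi z| <= sup E.
  by move=> z0; apply: ub_le_sup; [case: Esup|exists z].
have S0 : 0 < sup E.
  by apply: lt_le_trans (Eub _ zz0); rewrite normr_gt0.
have nR : 0 < n%:R :> R by rewrite ltr0n.
have q1 : (Num.sqrt n%:R)^-1 <= 1 :> R.
  by rewrite invf_le1 ?sqrtr_gt0 // -[leLHS]sqrtr1 ler_wsqrtr // ler1n.
have q0 : 0 <= (Num.sqrt n%:R)^-1 :> R by rewrite invr_ge0 sqrtr_ge0.
have key z : upper_half_plane z -> `|lambda n%:Z| * `|phi z| <= n%:R ^+ 2 * sup E.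
  move=> z0; have zp : 0 < z.2 by [].
  rewrite -normrM -(hm_hecke form n0 z0) /hecke normrM (ger0_norm q0).
  rewrite -[leRHS]mul1r; apply: ler_pM => //.
  apply: (le_trans (ler_norm_sum _ _ _)).
  apply: (@le_trans _ _ (\sum_(d <- divisors n) n%:R * sup E)).
    rewrite big_seq_cond [leRHS]big_seq_cond; apply: ler_sum => d /andP[dn _].
    have d_dvd : (d %| n)%N by rewrite dvdn_divisors.
    have d0 : (0 < d)%N by rewrite (dvdn_gt0 n0).
    have dle : (d <= n)%N by apply: dvdn_leq.
    apply: (le_trans (ler_norm_sum _ _ _)).
    apply: (@le_trans _ _ (\sum_(b < d) sup E)).
      apply: ler_sum => b _; apply: Eub; rewrite /upper_half_plane /=.
      rewrite divr_gt0 ?ltr0n // mulr_gt0 // ltr0n.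
      by rewrite divn_gt0.
    rewrite sumr_const card_ord -(mulr_natl (sup E) d) ler_pM2r // ler_nat //.
  rewrite big_const_seq iter_addr_0 count_predT -(mulr_natl (_ * sup E)) mulrA ler_pM2r // expr2.
  rewrite ler_pM2r // ler_nat.
  have : (size (divisors n) <= size (iota 1 n))%N.
    apply: uniq_leq_size; first exact: divisors_uniq.
    move=> d; rewrite -dvdn_divisors // mem_iota => dn.
    by rewrite (dvdn_gt0 n0 dn) add1n ltnS dvdn_leq.
  by rewrite size_iota.
have [l0|l0] := eqVneq (lambda n%:Z) 0; first by rewrite l0 normr0 exprn_ge0 // ltW.
have lp : 0 < `|lambda n%:Z| by rewrite normr_gt0.
rewrite -(ler_pM2r S0) -ler_pdivlMl //; apply: ge_sup; first by case: Esup.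
by move=> _ [z z0 <-]; rewrite ler_pdivlMl // key.
Qed.

Lemma besselg_turning_neq0 k : 4 <= k -> k ^+ 3 = t ^+ 2 -> besselg t (ln t) != 0.
Proof.
move=> k4 k3; apply/negP => /eqP e; have [s /negP] := besselg_neq0; apply; apply/eqP.
exact: (g_turning_eq0 t0 (der_besselg t) (der_besselg1 t) (besselg_bound t) k4 k3 e).
Qed.

End maass.

(** * Bessel functions in the transition range *)

Section transition_range.
Variable R : realType.

Lemma sum_inv_sqr_le2 N : \sum_(1 <= n < N.+1) (n%:R ^+ 2)^-1 <= 2 :> R.
Proof.
case: N => [|N]; first by rewrite big_nil.
(* Strengthened so that the induction step telescopes: 1/(x + 1)^2 <= 1/x - 1/(x + 1). *)
suff : \sum_(1 <= n < N.+2) (n%:R ^+ 2)^-1 <= 2 - N.+1%:R^-1 :> R.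
  by move/le_trans; apply; rewrite gerBl invr_ge0.
elim: N => [|N IHN]; first by rewrite big_nat1 expr1n invr1; lra.
rewrite big_nat_recr //=; apply: (le_trans (lerD IHN (lexx _))).
have : 0 < N.+1%:R :> R by rewrite ltr0n.
rewrite -[N.+2%:R]natr1; move: (N.+1%:R : R) => x x0.
rewrite -subr_ge0.
have -> : 2 - (x + 1)^-1 - (2 - x^-1 + ((x + 1) ^+ 2)^-1) = (x * (x + 1) ^+ 2)^-1.
  by field; rewrite !gt_eqF //; lra.
by rewrite invr_ge0 mulr_ge0 ?sqr_ge0 // ltW.
Qed.

(** * Bessel factors at v = 2 pi L y close to t, where t = m^3 and k = m^2 *)

Section fixed_scale.
Variables (L : nat) (m v th : R) (g g1 : R -> R).
Hypothesis dg : forall s, has_der g s (g1 s).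
Hypothesis dg1 : forall s, has_der g1 s ((expR s ^+ 2 - (m ^+ 3) ^+ 2) * g s).
Hypothesis gb : forall s, `|g s| <= 2 * expR (- s).
Hypothesis L0 : (0 < L)%N.
Hypothesis m2 : 2 <= m.
Hypothesis mL : 4 * L%:R <= m.
Hypothesis th0 : 0 < th.
Hypothesis thk : 2 * th <= (m ^+ 2)^-1 / 50.
Hypothesis thl : 32 * th * L%:R <= 1.
Hypothesis vt : `|v - m ^+ 3| <= th * m ^+ 3.

Local Notation t := (m ^+ 3).
Local Notation l := (L%:R : R).

Let t0 : 0 < t. Proof. by apply: exprn_gt0; have := m2; lra. Qed.
Let k4 : 4 <= m ^+ 2. Proof. by have := m2; nra. Qed.
Let k3 : (m ^+ 2) ^+ 3 = t ^+ 2. Proof. by rewrite -!exprM. Qed.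
Let l1 : 1 <= l. Proof. by rewrite ler1n. Qed.

Let vbounds : (1 - th) * t <= v <= (1 + th) * t.
Proof.
have := vt; rewrite ler_norml => /andP[h1 h2]; apply/andP; split; lra.
Qed.

Let th32 : th <= 1 / 32.
Proof. by have := thl; have := th0; have := l1; nra. Qed.

Let v0 : 0 < v.
Proof.
have /andP[h4 _] := vbounds; apply: lt_le_trans h4; rewrite mulr_gt0 //.
by have := th32; lra.
Qed.

(** The bound ln x <= x - 1, used for v/t and for t/v, puts ln v within 2 [th] of ln t; the factor 2
    pays for dividing by v instead of t. *)
Lemma bessel_transition_ge : `|g (ln t)| / 2 <= `|g (ln v)|.
Proof.
apply: (g_near_ge t0 dg dg1 gb k4 k3).
have h1 := th0; have h3 := th32; have ht := t0.
have /andP[b1 b2] := vbounds; have hv := v0.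
apply: le_trans thk.
rewrite -ln_div ?posrE // ler_norml; apply/andP; split.
  rewrite -[leRHS]opprK lerN2 -lnV ?posrE ?divr_gt0 // invf_div.
  have -> : t / v = 1 + (t / v - 1) by ring.
  apply: (@le_trans _ _ (t / v - 1)).
    by apply: le_ln1Dx; have := divr_gt0 ht hv; lra.
  by rewrite lerBlDr ler_pdivrMr //; nra.
have -> : v / t = 1 + (v / t - 1) by ring.
apply: (@le_trans _ _ (v / t - 1)).
  by apply: le_ln1Dx; have := divr_gt0 hv ht; lra.
by rewrite lerBlDr ler_pdivrMr //; nra.
Qed.

(** For n < L the argument u is at most (1 - c) t with c = 1/(2L), hence q >= c t = c m^3. Then
    [g_oscillating] gives g^2 <= D m^2 a^2 / (c m^3) = 2 D L a^2 / m, a gain of m^(-1/2) =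
    t^(-1/6). *)
Lemma bessel_oscillating_le (D b : R) (n : nat) : D = 3600 -> 0 < b ->
  (0 < n < L)%N -> 2 * D * l <= m * b ^+ 2 -> `|g (ln (n%:R / l * v))| <= b * `|g (ln t)|.
Proof.
move=> DE b0 /andP[n0 nL] hb.
have gosc := g_oscillating t0 dg dg1 gb k4 k3 DE; clear DE.
set u := n%:R / l * v.
have h1 := th0; have h2 := thl; have ht := t0; have hm := m2; have hl := l1.
have hml := mL.
have /andP[_ b2] := vbounds; have hv := v0.
have nR : 0 < n%:R :> R by rewrite ltr0n.
have u0 : 0 < u by rewrite mulr_gt0 // divr_gt0 //; lra.
(* Half of the gap 1/L between n/L and 1; the other half absorbs [th]. *)
pose c := (2 * l)^-1.
have c0 : 0 < c by rewrite invr_gt0; lra.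
have cl : c * l = 1 / 2 by rewrite /c; field; lra.
have cle : c <= 1 / 2 by nra.
have ut : u <= (1 - c) * t.
  have nl : n%:R / l <= 1 - 2 * c.
    rewrite ler_pdivrMr; last by lra.
    have : n%:R + 1 <= l by rewrite natr1 ler_nat.
    by lra.
  have thc : th <= c by rewrite -(ler_pM2r (x := l)); lra.
  apply: (@le_trans _ _ ((1 - 2 * c) * ((1 + c) * t))).
    have nl0 : 0 <= n%:R / l by rewrite divr_ge0.
    apply: ler_pM => //; first exact: ltW.
    by apply: (le_trans b2); rewrite ler_pM2r //; lra.
  by rewrite mulrA ler_pM2r //; nra.
have sle : ln u <= ln t - (m ^+ 2)^-1.
  rewrite -lerBlDl -ln_div ?posrE //.
  have e : u / t = 1 + (u / t - 1) by ring.
  have ut1 : u / t <= 1 - c by rewrite ler_pdivrMr.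
  rewrite e; apply: (@le_trans _ _ (u / t - 1)).
    by apply: le_ln1Dx; have := divr_gt0 u0 ht; lra.
  have : (m ^+ 2)^-1 <= c by rewrite lef_pV2 ?posrE //; nra.
  by lra.
move: (gosc _ sle).
have q : c * t <= wkbq t (ln u).
  rewrite /wkbq lnK ?posrE // -[leLHS]ger0_norm; last by rewrite mulr_ge0 // ltW.
  rewrite -sqrtr_sqr ler_wsqrtr // lerBrDr.
  have : u ^+ 2 <= ((1 - c) * t) ^+ 2 by rewrite lerXn2r ?nnegrE // ltW //; rewrite mulr_gt0 //; lra.
  have t2 : 0 < t ^+ 2 by rewrite exprn_gt0.
  by rewrite !exprMn; nra.
move=> h; rewrite -(ler_pXn2r (n:=2)) ?nnegrE ?mulr_ge0 ?(ltW b0) //.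
rewrite exprMn real_normK ?num_real //.
set A := `|g (ln t)| ^+ 2 in h *; have A0 : 0 <= A by rewrite sqr_ge0.
have ct : 0 < c * t by rewrite mulr_gt0.
rewrite -(ler_pM2l ct); apply: (@le_trans _ _ (D * m ^+ 2 * A)).
  by apply: le_trans h; rewrite ler_wpM2r ?sqr_ge0.
rewrite [X in _ <= X]mulrA ler_wpM2r //.
have -> : c * t * b ^+ 2 = c * m ^+ 2 * (m * b ^+ 2) by ring.
have : c * m ^+ 2 * (2 * D * l) <= c * m ^+ 2 * (m * b ^+ 2).
  by rewrite ler_pM2l // mulr_gt0 // exprn_gt0; lra.
by apply: le_trans; rewrite le_eqVlt; apply/orP; left; apply/eqP; rewrite /c; field; lra.
Qed.

(** In the variable log u exponential decay of rate [kap] is the power (u/w)^(-kap). Four units of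
    the exponent pay for n^4, because u/w >= n/(2L); the remaining ones produce b, because u/w >= 1
    + c. The lower bound on t says that [kap] = t/(2L) is large enough for both. *)
Lemma bessel_decaying_le (b : R) (n : nat) : 0 < b -> (L < n)%N ->
  2 * l * (4 + b^-1 / ln (1 + (8 * l)^-1)) <= t ->
  n%:R ^+ 4 * `|g (ln (n%:R / l * v))| <= 16 * l ^+ 4 * b * `|g (ln t)|.
Proof.
move=> b0 nL hb; set u := n%:R / l * v.
have h1 := th0; have h2 := thl; have ht := t0; have hm := m2; have hl := l1.
have /andP[b1 _] := vbounds; have hv := v0.
have nR : 0 < n%:R :> R by rewrite ltr0n (leq_ltn_trans (leq0n L)).
have u0 : 0 < u by rewrite mulr_gt0 // divr_gt0 //; lra.
pose c := (8 * l)^-1.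
have c0 : 0 < c by rewrite invr_gt0; lra.
have cl : c * l = 1 / 8 by rewrite /c; field; lra.
have cle : c <= 1 / 8 by nra.
have thc : th <= c / 4 by rewrite -(ler_pM2r (x := l)); lra.
(* An intermediate point beyond the turning point, where the rate [kap] is available, but still
   below u by a factor 1 + c. *)
pose w := (1 + 2 * c) * t.
have w0 : 0 < w by rewrite mulr_gt0 //; lra.
have tw : t <= w by rewrite -[leLHS]mul1r ler_pM2r //; lra.
pose kap := 4 * c * t.
have nl : 1 + 8 * c <= n%:R / l.
  rewrite ler_pdivlMr; last by lra.
  have : l + 1 <= n%:R by rewrite natr1 ler_nat.
  by lra.
have uw1 : 1 + c <= u / w.
  rewrite ler_pdivlMr // /w /u.
  apply: (@le_trans _ _ ((1 + 8 * c) * ((1 - c / 4) * t))).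
    by rewrite !mulrA ler_pM2r //; nra.
  apply: ler_pM => //; [lra|rewrite mulr_ge0 ?(ltW ht) //; lra|].
  by apply: le_trans b1; rewrite ler_pM2r //; lra.
have uw2 : n%:R / (2 * l) <= u / w.
  rewrite ler_pdivlMr // /w /u.
  apply: (@le_trans _ _ (n%:R / l * ((1 - c / 4) * t))); last first.
    apply: ler_wpM2l; first by rewrite divr_ge0 //; lra.
    by apply: le_trans b1; rewrite ler_pM2r //; lra.
  have -> : n%:R / (2 * l) = n%:R / l / 2 by field; lra.
  rewrite -[leLHS]mulrA; apply: ler_wpM2l; first by rewrite divr_ge0 //; lra.
  by rewrite mulrA ler_pM2r //; lra.
have kd : t ^+ 2 + kap ^+ 2 <= expR (ln w) ^+ 2.
  rewrite lnK ?posrE // /kap /w.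
  have t2 : 0 < t ^+ 2 by rewrite exprn_gt0.
  have -> : t ^+ 2 + (4 * c * t) ^+ 2 = (1 + 16 * c ^+ 2) * t ^+ 2 by ring.
  have -> : ((1 + 2 * c) * t) ^+ 2 = (1 + 2 * c) ^+ 2 * t ^+ 2 by ring.
  by rewrite ler_pM2r //; nra.
have kap0 : 0 <= kap by apply: ltW; rewrite /kap mulr_gt0 // mulr_gt0.
have uw : ln w <= ln u.
  rewrite ler_ln ?posrE //.
  by move: uw1; rewrite ler_pdivlMr //; nra.
have := ode_decay dg dg1 gb kap0 kd uw.
rewrite -ln_div ?posrE //.
have gw : `|g (ln w)| <= `|g (ln t)|.
  apply: (g_le_right t0 dg dg1 gb).
  by rewrite ler_ln ?posrE.
set rr := u / w in uw1 uw2 *.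
have rr0 : 0 < rr by rewrite divr_gt0.
have lnr : 0 < ln (1 + c) by rewrite ln_gt0 //; lra.
have lnrr : ln (1 + c) <= ln rr by rewrite ler_ln ?posrE //; lra.
have hk : 4 + b^-1 / ln (1 + c) <= kap.
  rewrite /kap /c; have -> : 4 * (8 * l)^-1 * t = t / (2 * l) by field; lra.
  rewrite ler_pdivlMr; last by lra.
  by rewrite mulrC.
have bV : 0 < b^-1 by rewrite invr_gt0.
have hx : b^-1 <= (kap - 4) * ln rr.
  apply: (@le_trans _ _ ((kap - 4) * ln (1 + c))).
    by rewrite -ler_pdivrMr //; lra.
  by rewrite ler_wpM2l //; have := divr_gt0 bV lnr; lra.
have hexp : expR (- (kap * ln rr)) <= b * rr ^- 4.
  have -> : - (kap * ln rr) = - ((kap - 4) * ln rr) - 4%:R * ln rr by ring.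
  rewrite expRD; apply: ler_pM; rewrite ?expR_ge0 //; last first.
    by rewrite expRN expRM_natl lnK ?posrE.
  rewrite expRN -[leRHS]invrK lef_pV2 ?posrE ?expR_gt0 //.
  by apply: (le_trans hx); have := expR_ge1Dx ((kap - 4) * ln rr); lra.
have hr : rr ^- 4 <= (2 * l) ^+ 4 / n%:R ^+ 4.
  have n4 : 0 < n%:R / (2 * l) by rewrite divr_gt0 //; lra.
  have -> : (2 * l) ^+ 4 / n%:R ^+ 4 = (n%:R / (2 * l)) ^- 4 by field; rewrite gt_eqF //=; lra.
  by rewrite lef_pV2 ?posrE ?exprn_gt0 // lerXn2r ?nnegrE ?(ltW n4) ?(ltW rr0).
have n40 : 0 < n%:R ^+ 4 :> R by rewrite exprn_gt0.
move=> hg; rewrite -ler_pdivlMl //.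
apply: (le_trans hg); rewrite mulrC.
apply: (@le_trans _ _ (b * ((2 * l) ^+ 4 / n%:R ^+ 4) * `|g (ln t)|)).
  apply: ler_pM; rewrite ?expR_ge0 //.
  by apply: (le_trans hexp); rewrite ler_pM2l.
by rewrite le_eqVlt; apply/orP; left; apply/eqP; field; rewrite gt_eqF.
Qed.

End fixed_scale.

End transition_range.

(** * Zeros near the height of the turning point *)

Section nodal.
Variable R : realType.

Lemma powR_cube_root (t : R) : 0 < t ->
  exists m, [/\ 0 < m, t = m ^+ 3 & t `^ (- (2 / 3)) = (m ^+ 2)^-1].
Proof.
move=> t0; exists (t `^ (1 / 3)); split; first exact: powR_gt0.
  rewrite -powR_mulrn ?powR_ge0 // -powRrM (_ : 1 / 3 * 3%:R = 1); last by field.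
  by rewrite powRr1 // ltW.
rewrite powRN; congr (_^-1).
rewrite -powR_mulrn ?powR_ge0 // -powRrM; congr (_ `^ _).
by field.
Qed.

Lemma nodal_cos_small (eps eta : R) (L : nat) : 0 < eps < 1 / 100 -> 0 < eta ->
  (0 < L)%N -> exists T, forall t, T <= t ->
  forall (phi : R * R -> R) (rho : int -> R[i]) (lambda : int -> R),
    even_hecke_maass_cusp_form phi t rho lambda -> eps <= `|lambda L%:Z| ->
  forall z, upper_half_plane z -> phi z = 0 ->
    `|z.2 - t / (2 * pi * L%:R)| <= eps * (t / (2 * pi * L%:R)) * t `^ (- (2 / 3)) ->
    `|cos (2 * pi * L%:R * z.1)| <= eta.
Proof.
move=> /andP[eps0 eps1] eta0 L0; pose l : R := L%:R.
have l1 : 1 <= l by rewrite ler1n.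
have l40 : 0 < l ^+ 4 by rewrite exprn_gt0 //; lra.
(* Chosen so that 2 b a, the bound for all terms n <> L together, equals [eta] times the lower bound
   eps a / 2 for the coefficient of the term n = L. *)
pose b := eta * eps / 4.
have b0 : 0 < b by rewrite divr_gt0 // mulr_gt0.
(* The divisors cancel the factors l^4 and 16 l^4 that arise for n < L and n > L. *)
pose b1 := b / l ^+ 4; pose b2 := b / (16 * l ^+ 4).
have b10 : 0 < b1 by rewrite divr_gt0.
have b20 : 0 < b2 by rewrite divr_gt0 // mulr_gt0.
have ln0 : 0 < ln (1 + (8 * l)^-1).
  rewrite ln_gt0 // ltrDl invr_gt0; lra.
have [D [D0 DE]] : exists D : R, 0 < D /\ D = 3600.
  by exists 3600; split; [rewrite ltr0n|reflexivity].
pose C1 := 2 * D * l / b1 ^+ 2.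
pose C2 := 2 * l * (4 + b2^-1 / ln (1 + (8 * l)^-1)).
have C10 : 0 <= C1.
  by rewrite divr_ge0 ?sqr_ge0 // mulr_ge0 ?mulr_ge0 ?(ltW D0) //; clear - l1; lra.
have C20 : 0 <= C2.
  rewrite mulr_ge0 //; first by lra.
  by rewrite addr_ge0 // divr_ge0 ?(ltW ln0) // invr_ge0 ltW.
pose C := 2 + 4 * l + C1 + C2.
exists (C ^+ 3) => t Ct phi rho lambda form hlam z z0 pz hz.
have t0 := hm_spectral_gt0 form.
have [m [m0 tE tk]] := powR_cube_root t0.
rewrite tk in hz; subst t; clear tk.
have Cm : C <= m.
  have C0 : 0 <= C by rewrite /C; clear - C10 C20 l1; lra.
  by move: Ct; rewrite ler_pXn2r ?nnegrE // ltW.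
have m2 : 2 <= m by apply: le_trans Cm; rewrite /C; clear - C10 C20 l1; lra.
have mL : 4 * l <= m by apply: le_trans Cm; rewrite /C; clear - C10 C20 l1; lra.
have mC1 : C1 <= m by apply: le_trans Cm; rewrite /C; clear - C10 C20 l1; lra.
have mC2 : C2 <= m ^+ 3.
  apply: (@le_trans _ _ m).
    by apply: le_trans Cm; rewrite /C; clear - C10 C20 l1; lra.
  by apply: ler_eXnr => //; clear - m2; lra.
have m20 : 0 < m ^+ 2 by rewrite exprn_gt0.
pose th := eps / m ^+ 2.
have th0 : 0 < th by rewrite divr_gt0.
have thk : 2 * th <= (m ^+ 2)^-1 / 50.
  rewrite /th mulrA mulrC ler_pM2l ?invr_gt0 //; clear - eps1; lra.
have thl : 32 * th * l <= 1.
  have -> : 32 * th * l = 32 * eps * l / m ^+ 2 by rewrite /th; ring.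
  rewrite ler_pdivrMr // mul1r; clear - eps1 eps0 mL l1 m2; nra.
have ln0' : l != 0 by rewrite gt_eqF //; clear - l1; lra.
have d0 : 0 < 2 * pi * l by rewrite !mulr_gt0 ?pi_gt0 //; clear - l1; lra.
pose v := 2 * pi * l * z.2.
have vt : `|v - m ^+ 3| <= th * m ^+ 3.
  have -> : v - m ^+ 3 = 2 * pi * l * (z.2 - m ^+ 3 / (2 * pi * l)).
    have aux (d y x : R) : d != 0 -> d * y - x = d * (y - x / d).
      by move=> dn0; field.
    by apply: aux; exact: lt0r_neq0.
  rewrite normrM gtr0_norm //.
  apply: (@le_trans _ _ (2 * pi * l * (eps * (m ^+ 3 / (2 * pi * l)) * (m ^+ 2)^-1))).
    by rewrite ler_pM2l.
  have aux (d e x k : R) : d != 0 -> d * (e * (x / d) * k) = e * k * x.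
    by move=> dn0; field.
  by rewrite aux //; exact: lt0r_neq0.
pose t := m ^+ 3.
have k4 : 4 <= m ^+ 2 by clear - m2; nra.
have k3 : (m ^+ 2) ^+ 3 = t ^+ 2 by rewrite /t -!exprM.
have [K [g [g1 [dg dg1 gb [Kg gt0 hcvg]]]]] : exists K g g1 : R -> R,
    [/\ forall s, has_der g s (g1 s),
        forall s, has_der g1 s ((expR s ^+ 2 - t ^+ 2) * g s),
        forall s, `|g s| <= 2 * expR (- s) &
        [/\ forall u, 0 < u -> K u = g (ln u), g (ln t) != 0 &
    \sum_(1 <= n < N.+1) lambda n%:Z * K (2 * pi * n%:R * z.2) * cos (2 * pi * n%:R * z.1)
      @[N --> \oo] --> (0 : R)]].
  exists (besselK_it t), (besselg t), (besselg1 t); split.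
  - exact: der_besselg.
  - exact: der_besselg1.
  - exact: besselg_bound.
  - split.
    + exact: K_besselg.
    + exact: besselg_turning_neq0 form _ k4 k3.
    + exact (cusp_zero_series form z0 pz).
pose a : R := `|g (ln t)|.
have a0 : 0 < a by rewrite normr_gt0.
have v0 : 0 < v by rewrite mulr_gt0.
have main : a / 2 <= `|K (2 * pi * l * z.2)|.
  rewrite Kg; last exact: v0.
  exact: (bessel_transition_ge dg dg1 gb L0 m2 th0 thk thl vt).
have other n : (0 < n)%N -> n != L ->
    `|lambda n%:Z * K (2 * pi * n%:R * z.2) * cos (2 * pi * n%:R * z.1)|
      <= b * a * (n%:R ^+ 2)^-1.
  move=> n0 nL; have nR : 1 <= n%:R :> R by rewrite ler1n.
  have nR0 : 0 < n%:R :> R by rewrite ltr0n.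
  have n20 : 0 < n%:R ^+ 2 :> R by rewrite exprn_gt0.
  have hl := lambda_bound form n0.
  rewrite Kg; last by rewrite mulr_gt0 // mulr_gt0 // mulr_gt0 ?pi_gt0.
  have -> : 2 * pi * n%:R * z.2 = n%:R / l * v.
    have aux (d y k x : R) : k != 0 -> d * x * y = x / k * (d * k * y).
      by move=> kn0; field.
    exact: aux.
  (* Two powers of n pay for [lambda_bound] and two make the sum over n converge. *)
  have hg : n%:R ^+ 4 * `|g (ln (n%:R / l * v))| <= b * a.
    have [nltL|Lltn|nE] := ltngtP n L; last by rewrite nE eqxx in nL.
      have hb1 : 2 * D * l <= m * b1 ^+ 2.
        by rewrite -ler_pdivrMr // exprn_gt0.
      have hn : (0 < n < L)%N by rewrite n0.
      have := bessel_oscillating_le dg dg1 gb L0 m2 mL th0 thl vt DE b10 hn hb1.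
      rewrite -/a -/l => h.
      have n4 : n%:R ^+ 4 <= l ^+ 4 by rewrite lerXn2r ?nnegrE // ler_nat ltnW.
      apply: (@le_trans _ _ (l ^+ 4 * (b1 * a))); first by apply: ler_pM.
      by rewrite mulrA /b1 [l ^+ 4 * _]mulrC divfK // gt_eqF.
    apply: (le_trans (bessel_decaying_le dg dg1 gb L0 m2 th0 thl vt b20 Lltn mC2)).
    rewrite -/a -/l.
    by rewrite /b2 [16 * _ * _]mulrC divfK // gt_eqF // mulr_gt0.
  have hc : `|cos (2 * pi * n%:R * z.1)| <= 1 by rewrite ler_norml cos_geN1 cos_le1.
  rewrite ler_pdivlMr // normrM normrM.
  apply: le_trans hg.
  set G := `|g _|; have G0 : 0 <= G by exact: normr_ge0.
  have h1 : `|lambda n%:Z| * G <= n%:R ^+ 2 * G by rewrite ler_wpM2r.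
  have h2 : `|lambda n%:Z| * G * `|cos (2 * pi * n%:R * z.1)| <= n%:R ^+ 2 * G * 1.
    by apply: ler_pM; rewrite ?mulr_ge0.
  apply: (@le_trans _ _ (n%:R ^+ 2 * G * 1 * n%:R ^+ 2)); first by rewrite ler_pM2r.
  by rewrite le_eqVlt; apply/orP; left; apply/eqP; ring.
have key : `|lambda L%:Z * K (2 * pi * l * z.2) * cos (2 * pi * l * z.1)| <= 2 * (b * a).
  have ba : 0 < b * a by rewrite mulr_gt0.
  apply/ler_addgt0Pl => e e0.
  have /cvgrPdist_le /(_ _ e0) [N1 _ hN1] := hcvg.
  have /= := hN1 (maxn L N1) (leq_maxr _ _); rewrite sub0r normrN.
  set N := maxn L N1; set f := fun n : nat => lambda n%:Z * K (2 * pi * n%:R * z.2) * cos (2 * pi * n%:R * z.1).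
  have LN : (L <= N)%N by exact: leq_maxl.
  have -> : \sum_(1 <= n < N.+1) f n = f L + \sum_(1 <= n < N.+1 | n != L) f n.
    rewrite (big_rem L) /=; last by rewrite mem_index_iota L0 ltnS.
    congr (_ + _); rewrite rem_filter ?iota_uniq // big_filter.
    exact: eq_bigl.
  move=> h; have hs : `|\sum_(1 <= n < N.+1 | n != L) f n| <= 2 * (b * a).
    apply: (le_trans (ler_norm_sum _ _ _)).
    apply: (@le_trans _ _ (\sum_(1 <= n < N.+1) b * a * (n%:R ^+ 2)^-1)); last first.
      by rewrite -mulr_sumr mulrC ler_pM2r // sum_inv_sqr_le2.
    rewrite big_mkcond big_nat_cond [leRHS]big_nat_cond; apply: ler_sum => n /andP[/andP[n1 _] _].
    case: ifP => nL; first exact: other.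
    by rewrite mulr_ge0 ?(ltW ba) // invr_ge0 sqr_ge0.
  have := ler_normB (f L + \sum_(1 <= n < N.+1 | n != L) f n) (\sum_(1 <= n < N.+1 | n != L) f n).
  by rewrite addrK => h3; apply: (le_trans h3); exact: lerD.
move: key; rewrite normrM normrM => key.
have low : eps * (a / 2) <= `|lambda L%:Z| * `|K (2 * pi * l * z.2)|.
  by apply: ler_pM => //; [exact: ltW|rewrite divr_ge0 // ltW].
have ea : 0 < eps * (a / 2) by rewrite mulr_gt0 // divr_gt0.
rewrite -(ler_pM2l ea).
apply: (@le_trans _ _ (2 * (b * a))).
  by apply: le_trans key; rewrite ler_wpM2r.
by rewrite le_eqVlt; apply/orP; left; apply/eqP; rewrite /b; field.
Qed.

(** With c the ceiling of 2Lx, the point x lies in the cell from (c - 1)/(2L) to c/(2L), whose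
    midpoint is (2c - 1)/(4L). The half-open range of x yields -L < c <= L. *)
Lemma nearest_odd (x : R) (L : nat) : (0 < L)%N -> - (1 / 2) < x <= 1 / 2 ->
  exists2 j : int, `|2 * j + 1| <= 2 * L%:Z &
    `|x - (2 * j + 1)%:~R / (4 * L%:R)| <= (4 * L%:R)^-1.
Proof.
move=> L0 /andP[x1 x2]; have LR : 0 < L%:R :> R by rewrite ltr0n.
have := ceil_itv (2 * L%:R * x); set c := Num.ceil _ => /andP[c1 c2].
rewrite intrD mulrN1z in c1.
exists (c - 1).
  have : (- L%:Z < c)%R.
    rewrite -(ltr_int R) mulrNz -pmulrn; apply: lt_le_trans c2; nra.
  have : c - 1 < L%:Z.
    rewrite -(ltr_int R) intrD mulrN1z -pmulrn; apply: (lt_le_trans c1); nra.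
  by lia.
have -> : x - (2 * (c - 1) + 1)%:~R / (4 * L%:R) =
   (2 * (2 * L%:R * x) - 2 * c%:~R + 1) * (4 * L%:R)^-1.
  rewrite !(intrD, intrM) mulrN1z -!pmulrn; field; lra.
rewrite normrM (@gtr0_norm _ (_^-1)) ?invr_gt0 ?mulr_gt0 //.
by rewrite ler_piMl ?invr_ge0 ?mulr_ge0 ?(ltW LR) // ler_norml; apply/andP; split; lra.
Qed.

Lemma odd_double1 (j : int) : odd (absz (2 * j + 1)).
Proof. by lia. Qed.

Lemma norm_cosDpi (j : int) (x : R) : `|cos (x + j%:~R * pi)| = `|cos x|.
Proof.
have h (n : nat) (y : R) : `|cos (y + n%:R * pi)| = `|cos y|.
  by rewrite mulr_natl (alternatingn (@cosDpi R)) normrM normrX normrN1 expr1n mul1r.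
case: j => n; first by rewrite -pmulrn h.
rewrite -(h n.+1 (x + _)) NegzE mulrNz -pmulrn; congr (`|cos _|).
by rewrite mulNr addrNK.
Qed.

(** At an odd multiple of pi/2 the cosine becomes, up to sign, the sine of 2 pi L times the offset;
    an offset of 1/(4L) corresponds exactly to pi/2, so the sine is increasing on the range used. *)
Lemma cos_large (x d : R) (L : nat) (j : int) : (0 < L)%N -> 0 < d <= (4 * L%:R)^-1 ->
  d <= `|x - (2 * j + 1)%:~R / (4 * L%:R)| <= (4 * L%:R)^-1 ->
  0 < sin (2 * pi * L%:R * d) <= `|cos (2 * pi * L%:R * x)|.
Proof.
move=> L0 /andP[d0 d1] /andP[h1 h2]; have LR : 0 < L%:R :> R by rewrite ltr0n.
have p0 := pi_gt0 R.
set e := x - _ in h1 h2.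
have xE : 2 * pi * L%:R * x = (2 * pi * L%:R * e + pi / 2) + j%:~R * pi.
  by rewrite /e intrD intrM -pmulrn; field; lra.
have P0 : 0 < 2 * pi * L%:R :> R by rewrite !mulr_gt0.
have top : 2 * pi * L%:R * (4 * L%:R)^-1 = pi / 2 :> R by field; lra.
rewrite xE norm_cosDpi cosDpihalf normrN.
have -> : `|sin (2 * pi * L%:R * e)| = `|sin (2 * pi * L%:R * `|e|)|.
  by case: (ler0P e) => _ //; rewrite mulrN sinN normrN.
have t1 : 0 < 2 * pi * L%:R * d by rewrite mulr_gt0.
have t2 : 2 * pi * L%:R * d <= 2 * pi * L%:R * `|e| by rewrite ler_pM2l.
have t3 : 2 * pi * L%:R * `|e| <= pi / 2 by rewrite -top ler_pM2l.
apply/andP; split.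
  by apply: sin_gt0_pi; apply/andP; split; lra.
apply: le_trans (ler_norm _).
rewrite leNgt ltr_sin ?in_itv /= -?leNgt //; apply/andP; split; lra.
Qed.

End nodal.

(** All forms with parameter t are quantified inside, so an admissible width d cannot depend on the
    form. *)
Definition strips_cover (R : realType) (eps t d : R) (l : int) : Prop :=
  forall (phi : R * R -> R) (rho : int -> R[i]) (lambda : int -> R),
    even_hecke_maass_cusp_form phi t rho lambda -> eps <= `|lambda l| ->
    nodal_line phi `&` nodal_region eps t l `<=`
    \bigcup_(m in [set m : int | odd `|m|%N /\ `|m| <= 2 * l])
      vertical_strip (m%:~R / (4 * l%:~R)) d.

Section strips.
Variable R : realType.
Implicit Types (eps t d : R).

Lemma strips_cover_wide eps t d (L : nat) : (0 < L)%N -> (4 * L%:R)^-1 < d ->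
  strips_cover eps t d L%:Z.
Proof.
move=> L0 Ld phi rho lambda form _ z [_ [zx _]].
have [j j1 j2] := nearest_odd L0 zx.
exists (2 * j + 1); first by split; [exact: odd_double1|].
by rewrite /vertical_strip /= -pmulrn; apply: le_lt_trans Ld.
Qed.

Lemma strips_coverS eps t d d' l : d <= d' -> strips_cover eps t d l ->
  strips_cover eps t d' l.
Proof.
move=> dd h phi rho lambda form hl z hz.
have [m hm mz] := h phi rho lambda form hl z hz.
by exists m => //; apply: lt_le_trans dd.
Qed.

Lemma strips_cover_level eps d (L : nat) : 0 < eps < 1 / 100 -> 0 < d -> (0 < L)%N ->
  exists T, forall t, T <= t -> strips_cover eps t d L%:Z.
Proof.
move=> eps01 d0 L0.
have [Ld|dL] := ltP (4 * L%:R)^-1 d.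
  by exists 0 => t _; exact: strips_cover_wide.
have LR : 0 < L%:R :> R by rewrite ltr0n.
have V0 : 0 < (4 * L%:R)^-1 :> R by rewrite invr_gt0 mulr_gt0.
pose eta := sin (2 * pi * L%:R * d) / 2.
have eta0 : 0 < eta.
  (* An auxiliary point at distance exactly 1/(4L) from its line, which only serves to read off from
     [cos_large] that the sine is positive. *)
  pose x : R := (4 * L%:R)^-1 + (2 * 0 + 1)%:~R / (4 * L%:R).
  have q : d <= `|x - (2 * 0 + 1)%:~R / (4 * L%:R)| <= (4 * L%:R)^-1.
    by rewrite addrK (ger0_norm (ltW V0)) lexx andbT.
  have d01 : 0 < d <= (4 * L%:R)^-1 by rewrite d0.
  by have /andP[s0 _] := cos_large L0 d01 q; rewrite divr_gt0.
have [T hT] := nodal_cos_small eps01 eta0 L0.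
exists T => t Tt phi rho lambda form hl z [[z0 pz] [zx zy]].
have [j j1 j2] := nearest_odd L0 zx.
exists (2 * j + 1); first by split; [exact: odd_double1|].
rewrite /vertical_strip /= -pmulrn ltNge; apply/negP => dj.
have zy' : `|z.2 - t / (2 * pi * L%:R)| <= eps * (t / (2 * pi * L%:R)) * t `^ (- (2 / 3)).
  by move: zy; rewrite /y_level -pmulrn.
have := hT t Tt phi rho lambda form hl z z0 pz zy'.
have d01 : 0 < d <= (4 * L%:R)^-1 by rewrite d0.
have dj2 : d <= `|z.1 - (2 * j + 1)%:~R / (4 * L%:R)| <= (4 * L%:R)^-1 by rewrite dj.
have /andP[s0 s1] := cos_large L0 d01 dj2.
by rewrite /eta; lra.
Qed.

Lemma strips_cover_all eps d : 0 < eps < 1 / 100 -> 0 < d ->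
  exists T, forall t, T <= t -> forall L : nat, (0 < L)%N -> strips_cover eps t d L%:Z.
Proof.
move=> eps01 d0; pose B := (Num.truncn d^-1).+1.
have small : exists T, forall t, T <= t -> forall L : nat, (0 < L < B)%N ->
    strips_cover eps t d L%:Z.
  elim: B => [|n [T hT]]; first by exists 0 => t _ L; rewrite ltn0 andbF.
  case: n hT => [_|n hT]; first by exists 0 => t _ [].
  have [T' hT'] := strips_cover_level eps01 d0 (ltn0Sn n).
  exists (Num.max T T') => t; rewrite ge_max => /andP[h1 h2] L /andP[L0].
  rewrite ltnS leq_eqVlt => /orP[/eqP ->|Ln]; first exact: hT'.
  by apply: hT => //; rewrite L0.
have [T hT] := small; exists T => t Tt L L0.
have [LB|BL] := ltnP L B; first by apply: hT => //; rewrite L0.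
apply: strips_cover_wide => //.
have LR : 0 < L%:R :> R by rewrite ltr0n.
have h : d^-1 < L%:R.
  by apply: (@lt_le_trans _ _ B%:R); [exact: truncnS_gt|rewrite ler_nat].
rewrite -[X in _ < X]invrK ltf_pV2 ?posrE ?invr_gt0 ?mulr_gt0 //; lra.
Qed.

End strips.

Theorem theorem4p3 (R : realType) :
  exists2 eps0 : R, 0 < eps0 &
  forall eps : R, 0 < eps < eps0 ->
  forall c C : R, 0 < c -> 0 < C ->
  exists2 w : R -> R, w T @[T --> +oo] --> 0 &
  forall (phi : R * R -> R) (t : R) (rho : int -> R[i]) (lambda : int -> R),
    even_hecke_maass_cusp_form phi t rho lambda ->
  forall l : int,
    c <= l%:~R -> l%:~R <= C * t `^ (1 / 6 - eps) ->
    eps <= `|lambda l| ->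
    nodal_line phi `&` nodal_region eps t l `<=`
    \bigcup_(m in [set m : int | odd `|m|%N /\ `|m| <= 2 * l])
      vertical_strip (m%:~R / (4 * l%:~R)) (w t).
Proof.
(* With this bound 2 eps <= 1/50, the radius in [g_near_ge]. *)
exists (1 / 100); first by lra.
move=> eps eps01 c C c0 _.
pose E t := [set d : R | 0 < d /\ forall L : nat, (0 < L)%N -> strips_cover eps t d L%:Z].
(* Width 1 always suffices, since 1/(4L) < 1; so the infimum below is over a nonempty set and is not
   a default value. *)
have E1 t : E t 1.
  split=> [//|L L0]; apply: strips_cover_wide => //.
  have LR : 1 <= L%:R :> R by rewrite ler1n.
  rewrite invf_lt1; lra.
have Elb t : has_lbound (E t) by exists 0 => d [/ltW].
have inf0 t : 0 <= inf (E t) by apply: lb_le_inf; [exists 1|move=> d [/ltW]].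
(* The infimum itself may fail to be admissible; the extra 1/t leaves room for an admissible width
   below and tends to 0. *)
exists (fun t => inf (E t) + t^-1).
  apply/cvgrPdist_le => e e0.
  have e2 : 0 < e / 2 by lra.
  have [T hT] := strips_cover_all eps01 e2.
  near=> t.
  have t1 : T <= t by near: t; apply: nbhs_pinfty_ge; rewrite num_real.
  have t2 : (e / 2)^-1 <= t by near: t; apply: nbhs_pinfty_ge; rewrite num_real.
  have t0 : 0 < t by apply: lt_le_trans t2; rewrite invr_gt0.
  have t3 : t^-1 <= e / 2 by rewrite -[leRHS]invrK lef_pV2 ?posrE ?invr_gt0.
  have t4 : 0 < t^-1 by rewrite invr_gt0.
  have i1 : inf (E t) <= e / 2 by apply: ge_inf => //; split=> // L L0; exact: hT.
  rewrite sub0r normrN ger0_norm; have := inf0 t; lra.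
move=> phi t rho lambda form l cl _ hl.
have t0 := hm_spectral_gt0 form.
have lt : inf (E t) < inf (E t) + t^-1 by rewrite ltrDl invr_gt0.
have [d [d0 hd] dw] := inf_lt (ex_intro _ 1 (E1 t)) lt.
have l0 : 0 < l by rewrite -(ltr_int R); apply: lt_le_trans cl.
case: l l0 cl hl => // L L0 _ hl.
by apply: (strips_coverS (ltW dw) (hd L _)) form hl.
Unshelve. all: by end_near. Qed.
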